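(* Let $r\leq 1$ be an integer coprime with $3$. Let $p\geq 7$ be a prime such that $p\equiv r\pmod 3$ and $p\geq 3-2r$. Then $$\sum_{k=0}^{p-1}(6k+r)\frac{(\frac{r}3)_k^6}{(1)_k^6}\equiv(-1)^{r+1}p\cdot\frac{\Gamma_p(\frac{r}{3})^6}{\Gamma_p(\frac{2r}3)^3}\sum_{k=0}^{1-r}\frac{(r-1)_k(\frac{r}3)_k^3}{(1)_k(\frac{2r}{3})_k^3}\pmod{p^5}.$$
   Context: $(a)_0=1$ and $(a)_k=a(a+1)\cdots(a+k-1)$ for $k\ge 1$ is the Pochhammer symbol. $\mathbb{Z}_p$ is the ring of $p$-adic integers; a congruence $x\equiv y\pmod{p^n}$ means $x-y\in p^n\mathbb{Z}_p$. $\Gamma_p$ is Morita's $p$-adic Gamma function ($p$ an odd prime): $\Gamma_p(0)=1$; for integers $n\ge1$, $\Gamma_p(n)=(-1)^n\prod_{1\le k<n,\ p\nmid k}k$; and for $x\in\mathbb{Z}_p$, $\Gamma_p(x)=\lim_{n\to x}\Gamma_p(n)$, where the limit is over integers $n\geq 1$ with $|n-x|_p\to0$. *)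

(* Defs.v *)
From HB Require Import structures.
From mathcomp Require Import all_boot all_order all_algebra.
From mathcomp Require Import boolp classical_sets filter topology.

Set Implicit Arguments.
Unset Strict Implicit.
Unset Printing Implicit Defensive.

Import Order.TTheory GRing.Theory Num.Theory.

Local Open Scope classical_set_scope.
Local Open Scope ring_scope.

Section Reduction.
Variable p : nat.

(* Z/p^(n+2) -> Z/p^(n+1).  For p <= 1 every 'Z_(p ^ n.+1) is 'Z_2, so that the
   ring structure below needs no hypothesis on p; it is the ring of p-adic
   integers when p is prime. *)
Definition Zp_reduce n (a : 'Z_(p ^ n.+2)) : 'Z_(p ^ n.+1) := (a : nat)%:R.

Lemma dvdn_Zp_trunc n :
  ((Zp_trunc (p ^ n.+1)).+2 %| (Zp_trunc (p ^ n.+2)).+2)%N.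
Proof.
have [p_gt1|] := ltnP 1 p; last first.
  by case: p => [|[|//]] _; rewrite ?exp0n ?exp1n.
by rewrite !Zp_cast ?dvdn_exp2l // -[1%N](expn0 p) ltn_exp2l.
Qed.

Lemma Zp_reduce_nat n m : Zp_reduce (m%:R : 'Z_(p ^ n.+2)) = m%:R.
Proof.
rewrite /Zp_reduce !Zp_nat; apply: val_inj => /=.
by rewrite modn_dvdm // dvdn_Zp_trunc.
Qed.

Lemma Zp_reduceD n (a b : 'Z_(p ^ n.+2)) :
  Zp_reduce (a + b) = Zp_reduce a + Zp_reduce b.
Proof. by rewrite -{1}(natr_Zp a) -{1}(natr_Zp b) -natrD Zp_reduce_nat natrD. Qed.

Lemma Zp_reduceM n (a b : 'Z_(p ^ n.+2)) :
  Zp_reduce (a * b) = Zp_reduce a * Zp_reduce b.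
Proof. by rewrite -{1}(natr_Zp a) -{1}(natr_Zp b) -natrM Zp_reduce_nat natrM. Qed.

Lemma Zp_reduce1 n : Zp_reduce (1 : 'Z_(p ^ n.+2)) = 1.
Proof. exact: (Zp_reduce_nat n 1). Qed.

Lemma Zp_reduce0 n : Zp_reduce (0 : 'Z_(p ^ n.+2)) = 0.
Proof. exact: (Zp_reduce_nat n 0). Qed.

Lemma Zp_reduceN n (a : 'Z_(p ^ n.+2)) : Zp_reduce (- a) = - Zp_reduce a.
Proof. by apply/eqP; rewrite -addr_eq0 -Zp_reduceD addNr Zp_reduce0. Qed.

Lemma Zp_reduceV n (a : 'Z_(p ^ n.+2)) : a \is a GRing.unit ->
  Zp_reduce a^-1 = (Zp_reduce a)^-1.
Proof.
move=> ua; have ab1 : Zp_reduce a^-1 * Zp_reduce a = 1.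
  by rewrite -Zp_reduceM mulVr // Zp_reduce1.
have ua' : Zp_reduce a \is a GRing.unit.
  by apply/unitrP; exists (Zp_reduce a^-1); split=> //; rewrite mulrC.
by rewrite -[LHS](mulrK ua') ab1 mul1r.
Qed.

End Reduction.

(* The p-adic integers as the inverse limit of the Z/p^(n+1), n >= 0. *)
Record padic (p : nat) := Padic {
  padic_val :> forall n, 'Z_(p ^ n.+1);
  padic_valP : forall n, Zp_reduce (padic_val n.+1) = padic_val n }.

Section PadicRing.
Variable p : nat.
Implicit Types x y z : padic p.

HB.instance Definition _ := gen_eqMixin (padic p).
HB.instance Definition _ := gen_choiceMixin (padic p).

Lemma padic_ext x y : (forall n, x n = y n) -> x = y.
Proof.
case: x y => [x xP] [y yP] /= exy.
have {}exy := functional_extensionality_dep exy.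
by case: y / exy yP => yP; congr Padic; apply: Prop_irrelevance.
Qed.

Definition padic0 : padic p := Padic (@Zp_reduce0 p).
Definition padic1 : padic p := Padic (@Zp_reduce1 p).

Fact padic_opp_subproof x n : Zp_reduce (- x n.+1) = - x n.
Proof. by rewrite Zp_reduceN padic_valP. Qed.
Definition padic_opp x := Padic (padic_opp_subproof x).

Fact padic_add_subproof x y n : Zp_reduce (x n.+1 + y n.+1) = x n + y n.
Proof. by rewrite Zp_reduceD !padic_valP. Qed.
Definition padic_add x y := Padic (padic_add_subproof x y).

Fact padic_mul_subproof x y n : Zp_reduce (x n.+1 * y n.+1) = x n * y n.
Proof. by rewrite Zp_reduceM !padic_valP. Qed.
Definition padic_mul x y := Padic (padic_mul_subproof x y).

Fact padic_addA : associative padic_add.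
Proof. by move=> x y z; apply: padic_ext => n; apply: addrA. Qed.
Fact padic_addC : commutative padic_add.
Proof. by move=> x y; apply: padic_ext => n; apply: addrC. Qed.
Fact padic_add0 : left_id padic0 padic_add.
Proof. by move=> x; apply: padic_ext => n; apply: add0r. Qed.
Fact padic_addN : left_inverse padic0 padic_opp padic_add.
Proof. by move=> x; apply: padic_ext => n; apply: addNr. Qed.

HB.instance Definition _ := GRing.isZmodule.Build (padic p)
  padic_addA padic_addC padic_add0 padic_addN.

Fact padic_mulA : associative padic_mul.
Proof. by move=> x y z; apply: padic_ext => n; apply: mulrA. Qed.
Fact padic_mulC : commutative padic_mul.
Proof. by move=> x y; apply: padic_ext => n; apply: mulrC. Qed.
Fact padic_mul1 : left_id padic1 padic_mul.
Proof. by move=> x; apply: padic_ext => n; apply: mul1r. Qed.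
Fact padic_mulD : left_distributive padic_mul +%R.
Proof. by move=> x y z; apply: padic_ext => n; apply: mulrDl. Qed.
Fact padic_oner_neq0 : padic1 != 0.
Proof.
apply/negP => /eqP/(congr1 (fun x : padic p => x 0%N))/eqP.
by rewrite [_ == _]oner_eq0.
Qed.

HB.instance Definition _ := GRing.Zmodule_isComNzRing.Build (padic p)
  padic_mulA padic_mulC padic_mul1 padic_mulD padic_oner_neq0.

Definition padic_unit : {pred padic p} :=
  fun x => `[< forall n, x n \is a GRing.unit >].

Fact padic_inv_subproof x (ux : forall n, x n \is a GRing.unit) n :
  Zp_reduce (x n.+1)^-1 = (x n)^-1.
Proof. by rewrite Zp_reduceV ?padic_valP. Qed.

Definition padic_inv x : padic p :=
  if pselect (forall n, x n \is a GRing.unit) is left ux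
  then Padic (padic_inv_subproof ux) else x.

Fact padic_mulV : {in padic_unit, left_inverse 1 padic_inv *%R}.
Proof.
move=> x /asboolP ux; rewrite /padic_inv; case: pselect => // ux'.
by apply: padic_ext => n; apply: mulVr (ux' n).
Qed.

Fact padic_unitPl x y : y * x = 1 -> padic_unit x.
Proof.
move=> yx1; apply/asboolP => n; apply/unitrP; exists (y n).
have yxn : y n * x n = 1 by rewrite -[LHS]/((y * x) n) yx1.
by split=> //; rewrite mulrC.
Qed.

Fact padic_inv_out : {in [predC padic_unit], padic_inv =1 id}.
Proof.
by move=> x /asboolP ux; rewrite /padic_inv; case: pselect => // /ux.
Qed.

HB.instance Definition _ := GRing.ComNzRing_hasMulInverse.Build (padic p)
  padic_mulV padic_unitPl padic_inv_out.

End PadicRing.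

Definition padic_eqmod (p m : nat) (x y : padic p) : Prop :=
  exists z : padic p, x - y = p%:R ^+ m * z.

Section PadicTopology.
Variable p : nat.
Implicit Types x y z : padic p.

Lemma padic_eqmod_refl m x : padic_eqmod m x x.
Proof. by exists 0; rewrite subrr mulr0. Qed.

Lemma padic_eqmod_trans m y x z :
  padic_eqmod m x y -> padic_eqmod m y z -> padic_eqmod m x z.
Proof.
move=> [a xy] [b yz]; exists (a + b).
by rewrite mulrDr -xy -yz addrA subrK.
Qed.

Lemma padic_eqmod_leq m m' x y :
  (m <= m')%N -> padic_eqmod m' x y -> padic_eqmod m x y.
Proof.
move=> /subnKC <- [a xy]; exists (p%:R ^+ (m' - m) * a).
by rewrite xy exprD mulrA.
Qed.

Definition padic_nbhs x : set_system (padic p) :=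
  filter_from setT (fun m => [set y | padic_eqmod m y x]).

HB.instance Definition _ := isPointed.Build (padic p) 0.
HB.instance Definition _ := hasNbhs.Build (padic p) padic_nbhs.

Fact padic_nbhs_filter x : ProperFilter (nbhs x).
Proof.
apply: filter_from_proper; last first.
  by move=> m _; exists x; apply: padic_eqmod_refl.
apply: filter_from_filter; first by exists 0%N.
move=> i j _ _; exists (maxn i j) => // y xy; split.
  exact: padic_eqmod_leq (leq_maxl i j) xy.
exact: padic_eqmod_leq (leq_maxr i j) xy.
Qed.

Fact padic_nbhs_singleton x (A : set (padic p)) : nbhs x A -> A x.
Proof. by case=> m _; apply; apply: padic_eqmod_refl. Qed.

Fact padic_nbhs_nbhs x (A : set (padic p)) : nbhs x A -> nbhs x (nbhs^~ A).
Proof.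
case=> m _ mA; exists m => // y yx; exists m => // z zy.
exact: mA (padic_eqmod_trans zy yx).
Qed.

HB.instance Definition _ := Nbhs_isNbhsTopological.Build (padic p)
  padic_nbhs_filter padic_nbhs_singleton padic_nbhs_nbhs.

End PadicTopology.

Definition pochhammer (R : pzRingType) (a : R) (k : nat) : R :=
  \prod_(i < k) (a + i%:R).

Definition pGamma_nat (p n : nat) : padic p :=
  (-1) ^+ n * \prod_(1 <= k < n | ~~ (p %| k)%N) k%:R.

(* The filter of positive integers n with |n - x|_p -> 0. *)
Definition padic_approx (p : nat) (x : padic p) : set_system nat :=
  filter_from setT (fun m => [set n | (0 < n)%N /\ padic_eqmod m n%:R x]).

(* For odd prime p the limit exists for every x; it is pGamma_nat p n at x = n
   for n >= 1, and 1 at x = 0. *)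
Definition pGamma (p : nat) (x : padic p) : padic p :=
  lim (pGamma_nat p n @[n --> padic_approx x]).

(* Main.v *)
(** Whipple's transformation followed by Sears' turns the very-well-poised sum
    with parameters a = r/3 and a - x_i (i < 5, where x_0 = p/3 makes it
    terminate) into an explicit product times a sum R of length 2 - r.  Taking
    x_i = zeta^i p/3 with zeta a primitive fifth root of unity changes the
    left-hand side only modulo p^5, because the product of the c - x_i is
    c^5 - x_0^5.  By Sears' transformation R is symmetric in the x_i, so as a
    polynomial in x_0 it is invariant under x_0 -> zeta x_0, and R = R(0)
    modulo p^5.  In terms of p-adic Gamma values the product factor is made of
    products of h(zeta^i x_0) over i < 5, for several functions h, and the same
    invariance reduces each of them to h(0)^5 modulo p^5.  Here Gamma_p on pZ_p
    is represented modulo p^5 by the truncated exponential of an odd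
    polynomial.  All of this takes place in (Z/p^5)[zeta]. *)
Require Import Defs.
From HB Require Import structures.
From mathcomp Require Import all_boot all_order all_algebra all_field.
From mathcomp Require Import boolp classical_sets filter topology.
From mathcomp Require Import qpoly ring zify.
Set Implicit Arguments.
Unset Strict Implicit.
Unset Printing Implicit Defensive.
Import Order.TTheory GRing.Theory Num.Theory.
Local Open Scope ring_scope.

(** * Terminating hypergeometric transformations *)

(** The congruence is proved in an abstract ring [A] with p^5 = 0, in which p/3 is a nilpotent [y].
    Non-units cannot be divided out there, and the substitution x_0 -> zeta x_0 acts on polynomials,
    so every hypergeometric identity has its denominators cleared and holds over an arbitrary
    commutative ring. With N = 1 - r and p + N = 3n + 1, the parameter r/3 is a = y - n; then a - y
    = -n terminates the series, and p >= 3 - 2r says N <= n. Comparing coefficients under x_0 ->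
    zeta x_0 needs units 1 - zeta^i for 0 < i < 5; their product is 5, invertible because p differs
    from 5. As Z_p contains zeta only when p = 1 modulo 5, the root is adjoined formally. The
    polynomial [g] that represents Gamma_p on multiples of p enters through three properties: g(0) =
    1, g(x) g(-x) = 1, and the functional equation across a block of length p. *)

Lemma bin_trinomial n j i : (j + i <= n)%N ->
  ('C(n, j + i) * 'C(j + i, j) = 'C(n, j) * 'C(n - j, i))%N.
Proof.
move=> le_n; have le_j : (j <= n)%N := leq_trans (leq_addr _ _) le_n.
have le_i : (i <= n - j)%N by rewrite leq_subRL.
apply/eqP; rewrite -(@eqn_pmul2r (j`! * (i`! * (n - j - i)`!))) ?muln_gt0 ?fact_gt0 //.
apply/eqP; transitivity n`!.
  rewrite -(bin_fact le_n) -(bin_fact (leq_addr i j)) addKn subnDA; ring.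
by rewrite -(bin_fact le_j) -(bin_fact le_i); ring.
Qed.

Section Hypergeometric.
Variable R : comNzRingType.
Implicit Types a b c d e s t : R.
Implicit Types f g h : nat -> R.

Local Notation poch := (@pochhammer R).

Lemma poch0 a : poch a 0 = 1.
Proof. by rewrite /pochhammer big_ord0. Qed.

Lemma pochS a k : poch a k.+1 = poch a k * (a + k%:R).
Proof. by rewrite /pochhammer big_ord_recr. Qed.

Lemma pochSl a k : poch a k.+1 = a * poch (a + 1) k.
Proof.
rewrite /pochhammer big_ord_recl addr0; congr (_ * _).
by apply: eq_bigr => i _; rewrite -addrA -natr1 [1 + _]addrC.
Qed.

Lemma pochD a j k : poch a (j + k) = poch a j * poch (a + j%:R) k.
Proof.
elim: k => [|k IHk]; first by rewrite addn0 poch0 mulr1.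
by rewrite addnS !pochS IHk natrD !addrA mulrA.
Qed.

Lemma poch_split a j n : (j <= n)%N ->
  poch a n = poch a j * poch (a + j%:R) (n - j).
Proof. by move=> le_jn; rewrite -pochD subnKC. Qed.

Lemma poch_rev a k : poch (1 - a - k%:R) k = (-1) ^+ k * poch a k.
Proof.
elim: k a => [|k IHk] a; first by rewrite !poch0 mulr1.
have -> : 1 - a - k.+1%:R = 1 - (a + 1) - k%:R by rewrite -natr1; ring.
by rewrite pochS IHk pochSl exprS; ring.
Qed.

Lemma poch_rev_eq a b k : a + b + k%:R = 1 -> poch b k = (-1) ^+ k * poch a k.
Proof.
move=> abk; rewrite -poch_rev; congr (poch _ k).
by rewrite -{1}abk; ring.
Qed.

Lemma poch1_fact k : poch 1 k = k`!%:R.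
Proof.
elim: k => [|k IHk]; first by rewrite poch0.
by rewrite pochS IHk factS mulnC natrM -natr1 [1 + _]addrC.
Qed.

Lemma signM_self k : (-1) ^+ k * (-1) ^+ k = 1 :> R.
Proof. by rewrite -exprD addnn -mul2n exprM sqrrN expr1n expr1n. Qed.

Lemma bin_poch n k : (k <= n)%N ->
  'C(n, k)%:R * poch 1 k = (-1) ^+ k * poch (- n%:R) k.
Proof.
move=> le_kn; rewrite poch1_fact -natrM bin_ffact.
elim: k le_kn => [_|k IHk lt_kn]; first by rewrite ffactn0 poch0 mulr1.
rewrite ffactnSr natrM IHk ?(ltnW lt_kn) // pochS exprS natrB ?(ltnW lt_kn) //.
by ring.
Qed.

(** The coefficients of a product of exponential generating functions; [poch s] is the sequence of
    (1 - z)^(-s). *)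
Definition bconv f g n := \sum_(k < n.+1) 'C(n, k)%:R * f k * g (n - k)%N.
Local Notation shift f := (fun k : nat => f k.+1).

Lemma eq_bconv f1 f2 g1 g2 n :
    (forall k, (k <= n)%N -> f1 k = f2 k) ->
    (forall k, (k <= n)%N -> g1 k = g2 k) ->
  bconv f1 g1 n = bconv f2 g2 n.
Proof.
move=> ef eg; apply: eq_bigr => k _.
by rewrite ef ?eg ?leq_subr // -ltnS.
Qed.

Lemma bconv0 f g : bconv f g 0 = f 0 * g 0.
Proof. by rewrite /bconv big_ord_recl big_ord0 addr0 bin0 mul1r. Qed.

Lemma bconvC f g n : bconv f g n = bconv g f n.
Proof.
rewrite /bconv (reindex_inj rev_ord_inj); apply: eq_bigr => k _ /=.
have le_kn : (k <= n)%N by rewrite -ltnS.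
by rewrite subSS bin_sub // subKn // mulrAC.
Qed.

(* The Leibniz rule for exponential generating functions. *)
Lemma bconvS f g n :
  bconv f g n.+1 = bconv (shift f) g n + bconv f (shift g) n.
Proof.
rewrite /bconv big_ord_recl bin0 mul1r subn0.
under eq_bigr => i _ do
  rewrite /= /bump /= add1n binS natrD !mulrDl subSS.
rewrite big_split /= addrA addrC; congr (_ + _).
rewrite [RHS]big_ord_recl bin0 mul1r subn0; congr (_ + _).
rewrite big_ord_recr /= bin_small // !mul0r addr0; apply: eq_bigr => i _.
by rewrite /bump /= add1n subnSK.
Qed.

Lemma bconvDl f1 f2 g n :
  bconv (fun k => f1 k + f2 k) g n = bconv f1 g n + bconv f2 g n.
Proof. by rewrite -big_split; apply: eq_bigr => k _; rewrite mulrDr mulrDl. Qed.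

Lemma bconvDr f g1 g2 n :
  bconv f (fun k => g1 k + g2 k) n = bconv f g1 n + bconv f g2 n.
Proof. by rewrite -big_split; apply: eq_bigr => k _; rewrite mulrDr. Qed.

Lemma bconvZ x f g n : bconv (fun k => x * f k) g n = x * bconv f g n.
Proof. by rewrite mulr_sumr; apply: eq_bigr => k _; ring. Qed.

Lemma bconvA f g h n : bconv f (bconv g h) n = bconv (bconv f g) h n.
Proof.
elim: n f g h => [|n IHn] f g h; first by rewrite !bconv0 mulrA.
rewrite !bconvS IHn.
have -> : bconv f (shift (bconv g h)) n =
    bconv f (fun k => bconv (shift g) h k + bconv g (shift h) k) n.
  by apply: eq_bconv => // k _; rewrite bconvS.
have -> : bconv (shift (bconv f g)) h n =
    bconv (fun k => bconv (shift f) g k + bconv f (shift g) k) h n.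
  by apply: eq_bconv => // k _; rewrite bconvS.
by rewrite bconvDr bconvDl !IHn addrA.
Qed.

(** Induction by the Leibniz rule: differentiating (1 - z)^(-s) multiplies it by s and raises s by
    one. *)
Lemma vandermonde s t n : bconv (poch s) (poch t) n = poch (s + t) n.
Proof.
elim: n s t => [|n IHn] s t; first by rewrite bconv0 !poch0 mulr1.
have pochSe u : forall k, (k <= n)%N -> poch u k.+1 = u * poch (u + 1) k.
  by move=> k _; apply: pochSl.
rewrite bconvS (eq_bconv (pochSe s) (fun k _ => erefl)) bconvZ.
rewrite (eq_bconv (fun k _ => erefl) (pochSe t)) [X in _ + X]bconvC bconvZ.
rewrite bconvC [bconv (poch (t + 1)) _ _]bconvC !IHn pochSl mulrDl.
by congr (_ * poch _ _ + _ * poch _ _); ring.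
Qed.

(** The Pfaff-Saalschuetz summation of a balanced 3F2, with denominators cleared. *)
Lemma saalschutz b c d k :
  \sum_(j < k.+1) 'C(k, j)%:R * (poch b j * poch c j * poch (d + j%:R) (k - j)
     * poch (d - b - c) (k - j)) = poch (d - b) k * poch (d - c) k.
Proof.
set s := d - b - c.
pose t k j := 'C(k, j)%:R *
  (poch b j * poch c j * poch (d + j%:R) (k - j) * poch s (k - j)).
rewrite -[LHS]/(\sum_(j < k.+1) t k j).
elim: k => [|k IHk].
  by rewrite big_ord_recl big_ord0 /t bin0 !poch0 !mul1r addr0.
(* A telescoping certificate for the recurrence in k: [t k.+1 j] differs from a multiple of [t k j]
   by [g j - g j.+1]. *)
pose g j := if j is i.+1 then 'C(k, i)%:R *
  (poch b j * poch c j * poch (d + i%:R) (k - i) * poch s (k - i)) else 0.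
have step j : (j <= k.+1)%N ->
    t k.+1 j = (d - b + k%:R) * (d - c + k%:R) * t k j - (g j.+1 - g j).
  case: j => [_|j].
    rewrite /t /g !bin0 !subn0 !pochS !poch0 /s !addr0.
    by ring.
  rewrite ltnS leq_eqVlt => /orP[/eqP ->|lt_jk].
    rewrite /t /g !subnn !binn bin_small // !poch0; ring.
  have -> : g j.+2 = 'C(k, j.+1)%:R * (poch b j.+2 * poch c j.+2 *
       poch (d + j.+1%:R) (k - j.+1) * poch s (k - j.+1)) by [].
  rewrite /t /g subSS binS natrD -(subnSK lt_jk) [poch (d + j%:R) _]pochSl.
  rewrite -[d + j%:R + 1]addrA natr1.
  set i := (k - j.+1)%N; have ek : k%:R = i%:R + j.+1%:R :> R.
    by rewrite -natrD subnK.
  rewrite [poch b j.+2]pochS [poch c j.+2]pochS [poch _ i.+1]pochS.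
  rewrite [poch s i.+1]pochS.
  have rel : 'C(k, j.+1)%:R * j.+1%:R = 'C(k, j)%:R * i.+1%:R :> R.
    by rewrite -!natrM mulnC mul_bin_left mulnC subnSK.
  move: (poch (d + _) i) (poch b _) (poch c _) (poch s i) => X1 X2 X3 X4.
  apply/eqP; rewrite -subr_eq0; apply/eqP.
  transitivity (X1 * X2 * X3 * X4 * (s + i%:R) *
    ('C(k, j)%:R * i.+1%:R - 'C(k, j.+1)%:R * j.+1%:R)); last first.
    by rewrite rel subrr mulr0.
  by rewrite ek /s -(natr1 i) -(natr1 j); ring.
rewrite !pochS mulrACA -IHk [RHS]mulrC.
rewrite (eq_bigr (fun j : 'I_k.+2 => (d - b + k%:R) * (d - c + k%:R) * t k j
  - (g j.+1 - g j))) => [|j _]; last exact: step _ (ltn_ord j).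
rewrite sumrB -mulr_sumr big_ord_recr /= [t k k.+1]/t bin_small // mul0r addr0.
rewrite -(big_mkord xpredT (fun j => g j.+1 - g j)) telescope_sumr //.
by rewrite /g bin_small // mul0r !subr0.
Qed.

(** Coefficient k of the Euler transformation; [poch (d + k%:R) (n - k)] stands for (d)_n / (d)_k,
    so that no division occurs. *)
Lemma saalschutz_bconv b c d n k : (k <= n)%N ->
  poch (d - b) k * poch (d - c) k * poch (d + k%:R) (n - k) =
  bconv (fun j => poch b j * poch c j * poch (d + j%:R) (n - j))
        (poch (d - b - c)) k.
Proof.
move=> le_kn; rewrite -saalschutz mulr_suml; apply: eq_bigr => j _.
have le_jk : (j <= k)%N by rewrite -ltnS.
rewrite (@poch_split (d + j%:R) (k - j) (n - j)) ?leq_sub2r //.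
have -> : d + j%:R + (k - j)%:R = d + k%:R by rewrite natrB //; ring.
have -> : (n - j - (k - j))%N = (n - k)%N by lia.
by ring.
Qed.

(* The coefficientwise form of the Euler transformations
   2F1(b, c; d) = (1 - z)^(d - b - c) 2F1(d - b, d - c; d): the two powers of
   1 - z cancel. *)
Lemma sears b c d b' c' d' n : (d - b - c) + (d' - b' - c') = 0 ->
  bconv (fun k => poch (d - b) k * poch (d - c) k * poch (d + k%:R) (n - k))
   (fun k => poch (d' - b') k * poch (d' - c') k * poch (d' + k%:R) (n - k)) n
  = bconv (fun k => poch b k * poch c k * poch (d + k%:R) (n - k))
      (fun k => poch b' k * poch c' k * poch (d' + k%:R) (n - k)) n.
Proof.
move=> ss'; rewrite (eq_bconv (@saalschutz_bconv b c d n) (@saalschutz_bconv b' c' d' n)).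
set u := fun k => _ * poch (d + _) _; set u' := fun k => _ * poch (d' + _) _.
rewrite -bconvA; apply: eq_bconv => // k _.
rewrite bconvA bconvC.
have -> : bconv (poch (d' - b' - c')) (bconv (poch (d - b - c)) u') k =
    bconv (poch 0) u' k.
  by rewrite bconvA -ss'; apply: eq_bconv => // i _; rewrite vandermonde addrC.
rewrite /bconv big_ord_recl bin0 poch0 !mul1r subn0 big1 ?addr0 // => i _.
by rewrite pochSl mul0r mulr0 mul0r.
Qed.

(* A very-well-poised series terminated by a parameter -n, multiplied by
   a (1 + a + n)_n to clear denominators; each wp_pair a b c n inserts the two
   parameters b and c, multiplied by (1 + a - b)_n (1 + a - c)_n. *)
Definition wp_sum a n (Y : nat -> R) := \sum_(k < n.+1)
  (-1) ^+ k * 'C(n, k)%:R * (a + k%:R *+ 2) * poch a k *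
  poch (1 + a + n%:R + k%:R) (n - k) * Y k.

Lemma wp_sum1 a n : wp_sum a n.+1 (fun=> 1) = 0.
Proof.
pose t k := (-1) ^+ k * 'C(n.+1, k)%:R * (a + k%:R *+ 2) * poch a k *
  poch (1 + a + n.+1%:R + k%:R) (n.+1 - k).
(* The series is indefinitely summable; at m = n this closed form is minus the last term. *)
have partial m : (m <= n)%N -> \sum_(k < m.+1) t k = (-1) ^+ m * 'C(n, m)%:R *
    poch a m.+1 * poch (1 + a + n.+1%:R + m%:R) (n.+1 - m).
  elim: m => [_|m IHm lt_mn].
    by rewrite big_ord_recl big_ord0 /t !bin0 [poch a 1]pochSl !poch0 /=; ring.
  rewrite big_ord_recr /= IHm ?(ltnW lt_mn) // /t subSS (subSn (ltnW lt_mn)).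
  rewrite -(subnSK lt_mn) binS natrD exprS.
  have rel : 'C(n, m.+1)%:R * m.+1%:R = 'C(n, m)%:R * (n - m.+1).+1%:R :> R.
    by rewrite -!natrM mulnC mul_bin_left mulnC subnSK.
  move: rel; set i := (n - m.+1)%N => rel.
  have en : n%:R = i%:R + m.+1%:R :> R by rewrite -natrD subnK.
  rewrite [poch (_ + m%:R) i.+2]pochSl -[_ + m%:R + 1]addrA natr1.
  rewrite [poch a m.+2]pochS.
  move: (poch (1 + a + n.+1%:R + m.+1%:R) i.+1) (poch a m.+1) => X1 X2.
  apply/eqP; rewrite -subr_eq0; apply/eqP.
  transitivity (X1 * X2 * (-1) ^+ m *
    ('C(n, m)%:R * i.+1%:R - 'C(n, m.+1)%:R * m.+1%:R)); last first.
    by rewrite rel subrr mulr0.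
  by rewrite -(natr1 n) en -(natr1 i) -(natr1 m); ring.
rewrite /wp_sum; under eq_bigr => k _ do rewrite mulr1.
rewrite big_ord_recr /= (partial n) // /t !binn subnn subSnn.
rewrite [poch _ 1]pochS !poch0 [poch a n.+1]pochS.
by rewrite exprS -(natr1 n); ring.
Qed.

(** The weight vanishes for k < j, and what remains after k = j + i is again very-well-poised, with
    a replaced by a + 2j. *)
Lemma wp_sum_shift a n j Y : (j <= n)%N ->
  wp_sum a n (fun k => 'C(k, j)%:R * poch (a + k%:R) j * Y k) =
  (-1) ^+ j * 'C(n, j)%:R * poch a (j + j) *
    wp_sum (a + j%:R *+ 2) (n - j) (fun i => Y (j + i)%N).
Proof.
move=> le_jn; rewrite /wp_sum.
set t := BIG_F; rewrite -[LHS](big_mkord xpredT (fun k => (-1) ^+ k *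
  'C(n, k)%:R * (a + k%:R *+ 2) * poch a k * poch (1 + a + n%:R + k%:R) (n - k) *
  ('C(k, j)%:R * poch (a + k%:R) j * Y k))) /= {}/t.
rewrite (@big_cat_nat _ _ _ j) //= ?leqW //.
rewrite big_nat big1 ?add0r => [|k /andP[_ lt_kj]]; last first.
  by rewrite (@bin_small k) // mul0r mul0r mulr0.
rewrite -{1}[j]add0n big_addn subSn // big_mkord mulr_sumr.
apply: eq_bigr => i _; have le_i : (i <= n - j)%N by rewrite -ltnS.
rewrite [(i + j)%N]addnC.
have le_n : (j + i <= n)%N by rewrite -leq_subRL.
have /(congr1 (fun m => m%:R : R)) := bin_trinomial le_n.
rewrite !natrM => bins; rewrite subnDA.
have -> : poch (1 + a + n%:R + (j + i)%:R) (n - j - i) =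
    poch (1 + (a + j%:R *+ 2) + (n - j)%:R + i%:R) (n - j - i).
  by congr (poch _ _); rewrite natrB // natrD; ring.
have -> : poch (a + j%:R *+ 2) i = poch (a + (j + j)%:R) i.
  by congr (poch _ _); rewrite natrD; ring.
have pp : poch a (j + i) * poch (a + (j + i)%:R) j =
    poch a (j + j) * poch (a + (j + j)%:R) i.
  by rewrite -!pochD addnAC.
rewrite natrD in pp *; rewrite exprD.
move: (poch _ (n - j - i)) => X.
transitivity ((-1) ^+ j * (-1) ^+ i * ('C(n, j + i)%:R * 'C(j + i, j)%:R) *
  (a + (j%:R + i%:R) *+ 2) * (poch a (j + i) * poch (a + (j%:R + i%:R)) j) * X
  * Y (j + i)%N); first by ring.
by rewrite bins pp; ring.
Qed.

Lemma wp_sum_sum a n m (Z : nat -> nat -> R) :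
  wp_sum a n (fun k => \sum_(j < m) Z j k) = \sum_(j < m) wp_sum a n (Z j).
Proof.
rewrite /wp_sum exchange_big; apply: eq_bigr => k _ /=.
by rewrite mulr_sumr.
Qed.

Lemma wp_sumZ a n x Y :
  wp_sum a n (fun k => x * Y k) = x * wp_sum a n Y.
Proof. by rewrite /wp_sum mulr_sumr; apply: eq_bigr => k _; ring. Qed.

Lemma eq_wp_sum a n Y Z : (forall k, (k <= n)%N -> Y k = Z k) ->
  wp_sum a n Y = wp_sum a n Z.
Proof. by move=> YZ; apply: eq_bigr => k _; rewrite YZ // -ltnS. Qed.

Definition wp_pair a b c n k := poch b k * poch c k *
  (poch (1 + a - b + k%:R) (n - k) * poch (1 + a - c + k%:R) (n - k)).

(** The weights 'C(k, j) (a + k)_j are those that [wp_sum_shift] absorbs, so this expansion trades a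
    pair of parameters for shifts of a. *)
Lemma wp_pairE a b c n k : (k <= n)%N ->
  wp_pair a b c n k = \sum_(j < n.+1)
    (-1) ^+ j * poch (1 + a - b - c) j * (poch (1 + a - b + j%:R) (n - j) *
       poch (1 + a - c + j%:R) (n - j)) *
    ('C(k, j)%:R * poch (a + k%:R) j).
Proof.
move=> le_kn; rewrite /wp_pair.
(* With these parameters the closed form is (c)_k (1 - b - k)_k, which is (b)_k (c)_k up to sign. *)
have ssz := saalschutz (1 + a - b - c) (a + k%:R) (1 + a - b) k.
have eb : poch (1 + a - b - (a + k%:R)) k = (-1) ^+ k * poch b k.
  by apply: poch_rev_eq; ring.
have ec : 1 + a - b - (1 + a - b - c) = c by ring.
rewrite eb ec in ssz.
have -> : poch b k * poch c k = (-1) ^+ k * (poch c k * ((-1) ^+ k * poch b k)).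
  transitivity ((-1) ^+ k * (-1) ^+ k * (poch b k * poch c k)); last by ring.
  by rewrite signM_self mul1r.
rewrite -ssz mulr_sumr mulr_suml.
rewrite [RHS](bigID (fun j : 'I_n.+1 => (j < k.+1)%N)) /=.
rewrite [X in _ = _ + X]big1 ?addr0 => [|j]; last first.
  by rewrite -leqNgt => lt_kj; rewrite bin_small // mul0r mulr0.
rewrite (@big_ord_widen_leq _ _ _ _ n.+1) //=.
apply: eq_big => [//|j le_jk]; rewrite inordK //.
have -> : poch (c - (a + k%:R)) (k - j) =
    (-1) ^+ (k - j) * poch (1 + a - c + j%:R) (k - j).
  by apply: poch_rev_eq; rewrite natrB //; ring.
rewrite (@poch_split (1 + a - b + j%:R) (k - j) (n - j)) ?leq_sub2r //.
rewrite (@poch_split (1 + a - c + j%:R) (k - j) (n - j)) ?leq_sub2r //.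
have ejk x : x + j%:R + (k - j)%:R = x + k%:R :> R by rewrite natrB //; ring.
rewrite !ejk.
have -> : (n - j - (k - j))%N = (n - k)%N by lia.
have -> : (-1) ^+ j = (-1) ^+ k * (-1) ^+ (k - j) :> R.
  by rewrite -{1}(subnK le_jk) exprD mulrAC signM_self mul1r.
by ring.
Qed.

(** Bailey's method: one pair is expanded and the sums are exchanged, so that each inner sum is
    very-well-poised without that pair. *)
Lemma wp_sum_pair a b c n Y :
  wp_sum a n (fun k => wp_pair a b c n k * Y k) = \sum_(j < n.+1)
    'C(n, j)%:R * poch (1 + a - b - c) j * (poch (1 + a - b + j%:R) (n - j) *
       poch (1 + a - c + j%:R) (n - j)) * poch a (j + j) *
    wp_sum (a + j%:R *+ 2) (n - j) (fun i => Y (j + i)%N).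
Proof.
pose w j := (-1) ^+ j * poch (1 + a - b - c) j *
  (poch (1 + a - b + j%:R) (n - j) * poch (1 + a - c + j%:R) (n - j)).
transitivity (wp_sum a n (fun k => \sum_(j < n.+1)
    w j * ('C(k, j)%:R * poch (a + k%:R) j * Y k))).
  apply: eq_wp_sum => k le_kn; rewrite wp_pairE // mulr_suml.
  by apply: eq_bigr => j _; rewrite -!mulrA.
rewrite (wp_sum_sum a n _
  (fun j k => w j * ('C(k, j)%:R * poch (a + k%:R) j * Y k))).
apply: eq_bigr => j _.
have le_jn : (j <= n)%N by rewrite -ltnS.
rewrite wp_sumZ wp_sum_shift // /w.
transitivity ((-1) ^+ j * (-1) ^+ j * ('C(n, j)%:R * poch (1 + a - b - c) j *
  (poch (1 + a - b + j%:R) (n - j) * poch (1 + a - c + j%:R) (n - j)) *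
  poch a (j + j) * wp_sum (a + j%:R *+ 2) (n - j) (fun i => Y (j + i)%N))).
  by ring.
by rewrite signM_self mul1r.
Qed.

(** With no further pair the inner sums for j < n vanish by [wp_sum1], which leaves the single term
    j = n. *)
Lemma wp_sum_5F4 a d e n :
  wp_sum a n (wp_pair a d e n) = poch a n.*2.+1 * poch (1 + a - d - e) n.
Proof.
rewrite -(@eq_wp_sum a n (fun k => wp_pair a d e n k * 1)) => [|k _]; last first.
  by rewrite mulr1.
rewrite (wp_sum_pair _ _ _ _ (fun=> 1)) big_ord_recr big1 ?add0r /= => [|j _].
  rewrite binn subnn !poch0 pochS -addnn natrD /wp_sum big_ord_recl big_ord0.
  by rewrite bin0 !poch0 /=; ring.
by rewrite -(subnSK (ltn_ord j)) wp_sum1 mulr0.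
Qed.

(* Whipple's 7F6 to 4F3 transformation. *)
Lemma whipple a b c d e n :
  wp_sum a n (fun k => wp_pair a b c n k * wp_pair a d e n k) =
  poch a n.*2.+1 * \sum_(j < n.+1)
    'C(n, j)%:R * poch d j * poch e j * poch (1 + a - b - c) j *
    poch (1 + a - d - e) (n - j) *
    poch (1 + a - b + j%:R) (n - j) * poch (1 + a - c + j%:R) (n - j).
Proof.
rewrite wp_sum_pair mulr_sumr; apply: eq_bigr => j _.
have le_jn : (j <= n)%N by rewrite -ltnS.
rewrite (@eq_wp_sum _ _ _ (fun i => poch d j * poch e j *
    wp_pair (a + j%:R *+ 2) (d + j%:R) (e + j%:R) (n - j) i)); last first.
  move=> i le_i; rewrite /wp_pair !pochD subnDA natrD.
  have eqd x : 1 + (a + j%:R *+ 2) - (x + j%:R) + i%:R = 1 + a - x + (j%:R + i%:R).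
    by ring.
  by rewrite !eqd; ring.
rewrite wp_sumZ wp_sum_5F4.
have -> : 1 + (a + j%:R *+ 2) - (d + j%:R) - (e + j%:R) = 1 + a - d - e by ring.
have -> : poch a n.*2.+1 =
    poch a (j + j) * poch (a + j%:R *+ 2) (n - j).*2.+1.
  have -> : n.*2.+1 = (j + j + (n - j).*2.+1)%N.
    by rewrite addnS addnn -doubleD subnKC.
  by rewrite pochD natrD mulr2n.
by ring.
Qed.

(** This form of the 4F3 has the parameter b + c + d + e - n - 2a - 1, which later specializes to -N
    and shortens the sum to N + 1 terms. *)
Lemma whipple_sears a b c d e n :
  wp_sum a n (fun k => wp_pair a b c n k * wp_pair a d e n k) =
  poch a n.*2.+1 * \sum_(j < n.+1)
    'C(n, j)%:R * poch d j * poch (d - a - n%:R) j *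
    poch (b + c + d + e - n%:R - a *+ 2 - 1) j *
    (poch (1 + a - d - b) (n - j) * poch (1 + a - d - c) (n - j) *
     poch (1 + a - d - e) (n - j)).
Proof.
rewrite whipple; congr (_ * _).
(* [D] and [D'] are chosen so that the lower-parameter factors, which Sears' transformation leaves
   alone, reverse to (1 + a - d - e)_(n-j) and (d)_j up to sign. *)
pose D := d + e - a - n%:R; pose D' := 1 - d - n%:R.
pose C := 1 + a - b - c.
have ss' : (D - e - C) + (D' - (b - a - n%:R) - (c - a - n%:R)) = 0.
  by rewrite /D /D' /C; ring.
have := @sears e C D (b - a - n%:R) (c - a - n%:R) D' n ss'.
move/(congr1 (fun x => (-1) ^+ n * x)); rewrite /bconv !mulr_sumr => S.
transitivity (\sum_(i < n.+1) (-1) ^+ n * ('C(n, i)%:R *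
   (poch e i * poch C i * poch (D + i%:R) (n - i)) *
   (poch (b - a - n%:R) (n - i) * poch (c - a - n%:R) (n - i) *
   poch (D' + (n - i)%:R) (n - (n - i))))).
  apply: eq_bigr => j _; have le_jn : (j <= n)%N by rewrite -ltnS.
  rewrite subKn //.
  have -> : poch (D + j%:R) (n - j) = (-1) ^+ (n - j) * poch (1 + a - d - e) (n - j).
    by apply: poch_rev_eq; rewrite /D natrB //; ring.
  have -> : poch (D' + (n - j)%:R) j = (-1) ^+ j * poch d j.
    by apply: poch_rev_eq; rewrite /D' natrB //; ring.
  have flip x : poch (x - a - n%:R) (n - j) =
      (-1) ^+ (n - j) * poch (1 + a - x + j%:R) (n - j).
    by apply: poch_rev_eq; rewrite natrB //; ring.
  rewrite !flip -[in (-1) ^+ n](subnKC le_jn) exprD /C.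
  move: (poch _ _) (poch _ _) (poch _ _) (poch _ _) (poch _ _) (poch _ _) =>
    X1 X2 X3 X4 X5 X6.
  transitivity ('C(n, j)%:R * X1 * X2 * X3 * X4 * X5 * X6 *
    ((-1) ^+ j * (-1) ^+ j) * ((-1) ^+ (n - j) * (-1) ^+ (n - j)) *
    ((-1) ^+ (n - j) * (-1) ^+ (n - j))); last by ring.
  by rewrite !signM_self !mulr1; ring.
rewrite -S; apply: eq_bigr => j _; have le_jn : (j <= n)%N by rewrite -ltnS.
rewrite subKn //.
have -> : poch (D + j%:R) (n - j) = (-1) ^+ (n - j) * poch (1 + a - d - e) (n - j).
  by apply: poch_rev_eq; rewrite /D natrB //; ring.
have -> : poch (D' + (n - j)%:R) j = (-1) ^+ j * poch d j.
  by apply: poch_rev_eq; rewrite /D' natrB //; ring.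
rewrite -[in (-1) ^+ n](subnKC le_jn) exprD.
have -> : D - e = d - a - n%:R by rewrite /D; ring.
have -> : D - C = b + c + d + e - n%:R - a *+ 2 - 1 by rewrite /D /C; ring.
have -> : D' - (b - a - n%:R) = 1 + a - d - b by rewrite /D'; ring.
have -> : D' - (c - a - n%:R) = 1 + a - d - c by rewrite /D'; ring.
move: (poch d _) (poch _ _) (poch _ _) (poch _ _) (poch _ _) (poch _ _) =>
  X1 X2 X3 X4 X5 X6.
transitivity ('C(n, j)%:R * X1 * X2 * X3 * X4 * X5 * X6 *
  ((-1) ^+ j * (-1) ^+ j) * ((-1) ^+ (n - j) * (-1) ^+ (n - j))); first by ring.
by rewrite !signM_self !mulr1; ring.
Qed.

End Hypergeometric.

Lemma rmorph_poch (R S : comNzRingType) (f : {rmorphism R -> S}) a k :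
  f (pochhammer a k) = pochhammer (f a) k.
Proof.
by rewrite rmorph_prod; apply: eq_bigr => i _; rewrite rmorphD rmorph_nat.
Qed.

Section RSum.
Variable R : comNzRingType.
Implicit Types a x : R.

(* A terminating balanced 4F3 with cleared denominators, where N = 1 - r. *)
Definition rsum N a xd xf xb xc xe : R := \sum_(j < N.+1) 'C(N, j)%:R *
  (pochhammer (a - xd) j * pochhammer (a - xf) j * pochhammer (a - xd - xf) j) *
  (pochhammer (a + xd + xf + xb) (N - j) * pochhammer (a + xd + xf + xc) (N - j)
     * pochhammer (a + xd + xf + xe) (N - j)).

Lemma rsum_sym N a xd xf xb xc xe :
  rsum N a xd xf xb xc xe = rsum N a xf xd xb xc xe.
Proof.
apply: eq_bigr => j _; rewrite [a - xd - xf]addrAC [a + xd + xf]addrAC.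
by rewrite [pochhammer (a - xd) j * _]mulrC.
Qed.

Lemma rsum_rot N a xd xf xb xc xe :
  rsum N a xd xf xb xc xe = rsum N a xd xf xe xb xc.
Proof. by apply: eq_bigr => j _; ring. Qed.

(** Sears' transformation again. It keeps (a - xd)_j and (a + xd + xf + xb)_(N-j), which are
    unaffected by the swap, and transforms the other four factors. With [rsum_sym] and [rsum_rot] it
    generates all permutations of the displacements. *)
Lemma rsum_swap N a xd xf xb xc xe : a *+ 3 + N%:R = 1 ->
    xd + xf + xb + xc + xe = 0 ->
  rsum N a xd xf xb xc xe = rsum N a xd xb xf xc xe.
Proof.
move=> aN x0.
have ea : N%:R = 1 - a *+ 3 by rewrite (canRL (addKr _) aN) addrC.
have exe : xe = - (xd + xf + xb + xc) by apply/eqP; rewrite -addr_eq0 addrC x0.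
pose D := a *+ 2 + xc + xe; pose D' := 1 - N%:R - (a - xd).
pose B := a - xf; pose C := a - xd - xf.
pose B' := a + xd + xf + xc; pose C' := a + xd + xf + xe.
have ss' : (D - B - C) + (D' - B' - C') = 0.
  by rewrite /D /D' /B /C /B' /C' ea exe; ring.
have := sears N ss'; move/(congr1 (fun x => (-1) ^+ N * x)).
rewrite /bconv !mulr_sumr.
have eB : D - B = a - xd - xb by rewrite /D /B exe; ring.
have eC : D - C = a - xb by rewrite /D /C exe; ring.
have eB' : D' - B' = a + xd + xb + xe by rewrite /D' /B' ea exe; ring.
have eC' : D' - C' = a + xd + xb + xc by rewrite /D' /C' ea exe; ring.
rewrite eB eC eB' eC'.
move=> S.
have flipD j : (j <= N)%N -> pochhammer (D + j%:R) (N - j) =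
    (-1) ^+ (N - j) * pochhammer (a + xd + xf + xb) (N - j).
  by move=> le_jN; apply: poch_rev_eq; rewrite natrB // /D ea exe; ring.
have flipD' j : (j <= N)%N -> pochhammer (D' + (N - j)%:R) (N - (N - j)) =
    (-1) ^+ j * pochhammer (a - xd) j.
  by move=> le_jN; rewrite subKn //; apply: poch_rev_eq; rewrite natrB // /D'; ring.
have {}flip X Y T U j : (j <= N)%N ->
    (-1) ^+ N * ('C(N, j)%:R * (X * Y * pochhammer (D + j%:R) (N - j)) *
      (T * U * pochhammer (D' + (N - j)%:R) (N - (N - j)))) =
    'C(N, j)%:R * (pochhammer (a - xd) j * X * Y) *
      (pochhammer (a + xd + xf + xb) (N - j) * T * U).
  move=> le_jN; rewrite flipD // flipD' // -[in (-1) ^+ N](subnKC le_jN) exprD.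
  move: (pochhammer _ _) (pochhammer _ _) => Z V.
  transitivity ('C(N, j)%:R * X * Y * Z * T * U * V *
    ((-1) ^+ j * (-1) ^+ j) * ((-1) ^+ (N - j) * (-1) ^+ (N - j))); first by ring.
  by rewrite !signM_self; ring.
rewrite /rsum; transitivity (\sum_(i < N.+1) (-1) ^+ N *
         ('C(N, i)%:R * (pochhammer B i * pochhammer C i * pochhammer (D + i%:R) (N - i)) *
          (pochhammer B' (N - i) * pochhammer C' (N - i) *
           pochhammer (D' + (N - i)%:R) (N - (N - i))))).
  by apply: eq_bigr => j _; rewrite flip // -ltnS.
rewrite -S; apply: eq_bigr => j _; rewrite flip -1?ltnS //.
rewrite -[in pochhammer (a + xd + xf + xb)]addrA [xf + xb]addrC addrA; ring.
Qed.

End RSum.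

Lemma rmorph_rsum (R S : comNzRingType) (f : {rmorphism R -> S})
    N a xd xf xb xc xe :
  f (rsum N a xd xf xb xc xe) = rsum N (f a) (f xd) (f xf) (f xb) (f xc) (f xe).
Proof.
rewrite rmorph_sum; apply: eq_bigr => j _.
by rewrite !rmorphM !rmorph_poch rmorph_nat !(rmorphB, rmorphD).
Qed.

(** * Substituting fifth roots of unity *)

Section Cyclotomic.
Variables (A : comUnitRingType) (z : A).
Hypothesis z5 : 1 + z + z ^+ 2 + z ^+ 3 + z ^+ 4 = 0.
Hypothesis unit5 : (5%:R : A) \is a GRing.unit.

Lemma zeta5 : z ^+ 5 = 1.
Proof.
apply/eqP; rewrite -subr_eq0; apply/eqP.
by rewrite -[RHS](mulr0 (z - 1)) -z5; ring.
Qed.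

Lemma unit_1Bzeta i : (0 < i < 5)%N -> 1 - z ^+ i \is a GRing.unit.
Proof.
have e5 : (1 - z ^+ 1) * (1 - z ^+ 2) * (1 - z ^+ 3) * (1 - z ^+ 4) = 5%:R.
  (* The product is Phi_5(1) = 5; the last factor is the quotient of the product minus 5 by 1 + z +
     ... + z^4. *)
  transitivity (5%:R + (1 + z + z ^+ 2 + z ^+ 3 + z ^+ 4) *
    (z ^+ 6 - 2 * z ^+ 5 + z ^+ 3 + 3 * z - 4)); first by ring.
  by rewrite z5 mul0r addr0.
move: unit5; rewrite -e5 !unitrM => /andP[/andP[/andP[u1 u2] u3] u4].
by case: i => [|[|[|[|[|]]]]].
Qed.

Lemma coef_comp_scaleX (q : {poly A}) i : (q \Po (z *: 'X))`_i = q`_i * z ^+ i.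
Proof.
rewrite comp_polyE.
have -> : \sum_(i < size q) q`_i *: (z *: 'X) ^+ i = \poly_(i < size q) (q`_i * z ^+ i).
  by rewrite poly_def; apply: eq_bigr => j _; rewrite exprZn scalerA.
by rewrite coef_poly; case: ltnP => // le_qi; rewrite nth_default // mul0r.
Qed.

(** Invariance gives q_i (1 - z^i) = 0, which kills the coefficients of degree 1 to 4, and y^5 = 0
    kills the higher terms. *)
Lemma horner_zeta_invariant (q : {poly A}) y :
  q \Po (z *: 'X) = q -> y ^+ 5 = 0 -> q.[y] = q.[0].
Proof.
move=> qz y5; have q0 i : (0 < i < 5)%N -> q`_i = 0.
  move=> /unit_1Bzeta u; apply: (mulIr u); rewrite mul0r mulrBr mulr1.
  by rewrite -coef_comp_scaleX qz subrr.
rewrite horner_coef0 horner_coef; case e: (size q) => [|n].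
  by rewrite big_ord0 nth_default ?e.
rewrite big_ord_recl expr0 mulr1 big1 ?addr0 // => i _ /=.
have [lt_i5|le_5i] := ltnP i.+1 5; first by rewrite /bump q0 ?mul0r.
by rewrite /bump add1n -(subnKC le_5i) exprD y5 mul0r mulr0.
Qed.

(** Replacing x by z x permutes the five factors cyclically, so their product is an invariant
    polynomial. *)
Lemma prod_zeta_horner (q : {poly A}) y : y ^+ 5 = 0 ->
  q.[y] * q.[z * y] * q.[z ^+ 2 * y] * q.[z ^+ 3 * y] * q.[z ^+ 4 * y]
  = q.[0] ^+ 5.
Proof.
move=> y5; pose h k := q \Po (z ^+ k *: 'X).
have hE k x : (h k).[x] = q.[z ^+ k * x] by rewrite horner_comp hornerZ hornerX.
have hS k : h k \Po (z *: 'X) = h k.+1.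
  by rewrite /h -comp_polyA comp_polyZ comp_polyX scalerA -exprSr.
have h5 : h 5 = h 0 by rewrite /h zeta5 expr0.
have := @horner_zeta_invariant (h 0 * h 1 * h 2 * h 3 * h 4) y.
rewrite !hornerM !hE !mulr0 expr0 mul1r expr1 => -> //.
  by rewrite -!expr2 -!exprSr.
by rewrite !comp_polyM !hS h5; ring.
Qed.

Lemma rsum_zeta N a y : a *+ 3 + N%:R = 1 -> y ^+ 5 = 0 ->
  rsum N a (z * y) y (z ^+ 2 * y) (z ^+ 3 * y) (z ^+ 4 * y) =
  rsum N a 0 0 0 0 0.
Proof.
move=> aN y5; pose x k : {poly A} := z ^+ k *: 'X.
pose q := rsum N a%:P (x 1) (x 0) (x 2) (x 3) (x 4).
have qE u : q.[u] = rsum N a (z * u) u (z ^+ 2 * u) (z ^+ 3 * u) (z ^+ 4 * u).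
  rewrite -[q.[u]]/(horner_eval u q) rmorph_rsum /= /horner_eval.
  by rewrite !hornerZ !hornerX hornerC expr0 mul1r.
have xS k : x k \Po (z *: 'X) = x k.+1.
  by rewrite /x comp_polyZ comp_polyX scalerA -exprSr.
have x5 : x 5 = x 0 by rewrite /x zeta5 expr0.
rewrite -qE (@horner_zeta_invariant q) // ?qE ?mulr0 //.
rewrite -[LHS]/(comp_poly (z *: 'X) q) rmorph_rsum /= comp_polyC !xS x5.
(* The substitution shifts the displacements cyclically; these three symmetries shift them back. *)
rewrite rsum_sym rsum_rot rsum_swap //.
- by rewrite -polyCMn -polyC_natr -polyCD aN.
- transitivity ((1 + z + z ^+ 2 + z ^+ 3 + z ^+ 4) *: ('X : {poly A})).
    by rewrite !scalerDl /x expr0 expr1; ring.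
  by rewrite z5 scale0r.
Qed.

End Cyclotomic.

(** * Rising products modulo p *)

Lemma unitr_natr (A : comUnitRingType) p n k : prime p -> ~~ (p %| k)%N ->
  (p%:R : A) ^+ n = 0 -> (k%:R : A) \is a GRing.unit.
Proof.
move=> pp pk pn0; have k0 : (0 < k)%N by case: k pk => //; rewrite dvdn0.
have : coprime k (p ^ n) by rewrite coprimeXr // coprime_sym prime_coprime.
rewrite /coprime => /eqP kp.
case: (egcdnP (p ^ n) k0) => u v; rewrite kp => uk _.
apply/unitrP; exists u%:R; suff uk1 : u%:R * k%:R = 1 :> A by split=> //; rewrite mulrC.
by rewrite -natrM uk natrD natrM natrX pn0 mulr0 add0r.
Qed.

Lemma unitrD_nilp (A : comUnitRingType) (x v : A) :
  x \is a GRing.unit -> v ^+ 5 = 0 -> x + v \is a GRing.unit.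
Proof.
move=> ux v5; have := unitrX 5 ux; have -> : x ^+ 5 =
    (x + v) * (x ^+ 4 - x ^+ 3 * v + x ^+ 2 * v ^+ 2 - x * v ^+ 3 + v ^+ 4).
  by rewrite -[LHS]addr0 -v5; ring.
by rewrite unitrM => /andP[].
Qed.

(** The factors for j and p - j are multiplied together. *)
Lemma prod_pairs (B : comNzRingType) h (x : B) :
  let p := h.*2.+1 in
  \prod_(1 <= j < p) (x + j%:R) =
  \prod_(1 <= j < h.+1) (x * (x + p%:R) + (j * (p - j))%:R).
Proof.
move=> p; have -> : p = (h.+1 + h)%N by rewrite addSn addnn.
rewrite (@big_cat_nat _ _ _ h.+1) //=; last by lia.
have shift (F : nat -> B) : \prod_(h.+1 <= i < h.+1 + h) F i =
    \prod_(1 <= j < h.+1) F (j + h)%N.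
  by rewrite -{1}[h.+1]add1n big_addn addnK.
rewrite [X in _ * X]big_nat_rev shift.
rewrite -big_split big_nat [RHS]big_nat; apply: eq_bigr => j /andP[j1 jh] /=.
have -> : (h.+1 + (h.+1 + h) - (j + h).+1)%N = (h.+1 + h - j)%N by lia.
have le_j : (j <= h.+1 + h)%N by lia.
by rewrite natrM natrB //; ring.
Qed.

Lemma prod_Fp p : prime p ->
  \prod_(1 <= j < p) ('X + j%:R) = 'X^(p.-1) - 1 :> {poly 'F_p}.
Proof.
move=> pp; apply: (@mulfI _ 'X); first by rewrite polyX_eq0.
have := finField_genPoly 'F_p; rewrite card_Fp // (reindex_inj oppr_inj) /=.
rewrite mulrBr mulr1 -exprS prednK ?prime_gt0 // => ->.
have -> : \prod_(j : 'F_p) ('X - (- j)%:P) =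
    \prod_(j < (Zp_trunc (pdiv p)).+2) ('X + (j : nat)%:R) :> {poly 'F_p}.
  apply: eq_bigr => j _; rewrite polyCN opprK -polyC_natr; congr (_ + _%:P).
  by rewrite natr_Zp.
rewrite -(big_mkord xpredT (fun j => 'X + j%:R)) Fp_cast //.
by rewrite [RHS]big_ltn ?prime_gt0 // addr0.
Qed.

(** By [prod_pairs], (x + 1)...(x + p - 1) is the value of this polynomial at x (x + p), where p =
    2h + 1. *)
Definition psi h : {poly int} :=
  \prod_(1 <= j < h.+1) ('X + (j * (h.*2.+1 - j))%:R).

Lemma map_psi (A : comNzRingType) h : map_poly intr (psi h) =
  \prod_(1 <= j < h.+1) ('X + (j * (h.*2.+1 - j))%:R) :> {poly A}.
Proof.
rewrite rmorph_prod; apply: eq_bigr => j _.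
by rewrite rmorphD /= map_polyX rmorph_nat.
Qed.

(** Over F_p the argument x (x + p) is x^2, so psi(X^2) = X^(p-1) - 1, which has only its two
    extreme coefficients. *)
Lemma dvdz_coef_psi h i : prime h.*2.+1 -> (0 < i < h)%N ->
  (h.*2.+1 %| (psi h)`_i)%Z.
Proof.
set p := h.*2.+1 => pp /andP[i0 ih].
rewrite (dvdz_pcharf (pchar_Fp pp)) -coef_map map_psi /=.
set q := \prod_(_ <= _ < _) _.
suff : q \Po 'X^2 = 'X^(p.-1) - 1.
  move/(congr1 (fun q : {poly 'F_p} => q`_(i * 2))); rewrite coef_comp_poly_Xn // dvdn_mull //.
  rewrite mulnK // => ->; rewrite coefB coefXn coef1.
  have -> : (i * 2 == p.-1)%N = false by rewrite /p; lia.
  have -> : (i * 2 == 0)%N = false by lia.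
  by rewrite subrr.
rewrite -prod_Fp // prod_pairs -/p /q rmorph_prod; apply: eq_bigr => j _.
rewrite rmorphD /= comp_polyX rmorph_nat -[p%:R]polyC_natr.
by rewrite pchar_Fp_0 // addr0.
Qed.

(** * The p-adic Gamma function on pZ_p modulo p^5 *)

Section GammaPolynomial.
Variables (A : comUnitRingType) (p : nat).
Hypotheses (p_prime : prime p) (p_ge7 : (7 <= p)%N).
Local Notation P := (p%:R : A).
Hypothesis P5 : P ^+ 5 = 0.

Lemma nilpP t : (P * t) ^+ 5 = 0.
Proof. by rewrite exprMn P5 mul0r. Qed.

Lemma unit_nat k : ~~ (p %| k)%N -> (k%:R : A) \is a GRing.unit.
Proof. by move=> pk; apply: unitr_natr p_prime pk P5. Qed.

Lemma unit_lt k : (0 < k < p)%N -> (k%:R : A) \is a GRing.unit.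
Proof.
by case/andP=> k0 kp; apply: unit_nat; rewrite gtnNdvd.
Qed.

Lemma unit_poch x k : (k < p)%N -> pochhammer (1 + P * x) k \is a GRing.unit.
Proof.
move=> lt_kp; rewrite rpred_prod // => i _.
have -> : 1 + P * x + i%:R = i.+1%:R + P * x by rewrite -natr1; ring.
rewrite unitrD_nilp ?nilpP // unit_lt //.
exact: leq_ltn_trans (ltn_ord i) lt_kp.
Qed.

Lemma unit_poch1 k : (k < p)%N -> pochhammer (1 : A) k \is a GRing.unit.
Proof. by move/(unit_poch 0); rewrite mulr0 addr0. Qed.

Lemma unit2 : (2%:R : A) \is a GRing.unit. Proof. by rewrite unit_lt //; lia. Qed.
Lemma unit3 : (3%:R : A) \is a GRing.unit. Proof. by rewrite unit_lt //; lia. Qed.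
Lemma unit5 : (5%:R : A) \is a GRing.unit. Proof. by rewrite unit_lt //; lia. Qed.

Lemma unit12 : (12%:R : A) \is a GRing.unit.
Proof. by rewrite -[12%N]/(2 * 2 * 3)%N !natrM !unitrM unit2 unit3. Qed.
Lemma unit24 : (24%:R : A) \is a GRing.unit.
Proof. by rewrite -[24%N]/(12 * 2)%N natrM unitrM unit2 unit12. Qed.

Definition texp_num (R : comNzRingType) (x : R) :=
  24 + 24 * x + 12 * x ^+ 2 + 4 * x ^+ 3 + x ^+ 4.
Definition texp (x : A) := 24%:R^-1 * texp_num x.

Lemma texp0 : texp 0 = 1.
Proof. by rewrite /texp /texp_num !expr0n !mulr0 !addr0 mulVr // unit24. Qed.

Lemma texpD s t : texp (P * s) * texp (P * t) = texp (P * (s + t)).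
Proof.
have e : texp_num (P * s) * texp_num (P * t) = 24%:R * texp_num (P * (s + t)).
  (* The long factor collects the terms of total degree at least 5, divided by P^5. *)
  rewrite -[RHS]addr0 -(mul0r (24*s^+1*t^+4 + 48*s^+2*t^+3 + 12*P^+1*s^+2*t^+4
   + 48*s^+3*t^+2 + 16*P^+1*s^+3*t^+3 + 4*P^+2*s^+3*t^+4 + 24*s^+4*t^+1
   + 12*P^+1*s^+4*t^+2 + 4*P^+2*s^+4*t^+3 + P^+3*s^+4*t^+4)) -P5.
  by rewrite /texp_num; ring.
by rewrite /texp mulrACA e mulrA mulrVK ?unit24.
Qed.

(** A logarithm, by descending induction on the exponent of P: multiplying 1 + x by exp(-x) leaves 1
    + O(x^2), and x^2 has at least one more factor P than x. *)
Lemma texp_surj w : exists c, texp (P * c) = 1 + P * w.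
Proof.
suff surj k : (k < 5)%N -> forall w, exists c, texp (P * c) = 1 + P ^+ (5 - k) * w.
  exact: surj 4 isT w.
elim: k => [_ {}w|k IHk lt_k {}w]; first by exists 0; rewrite P5 mulr0 mul0r texp0 addr0.
have -> : (5 - k.+1 = (5 - k.+2).+1)%N by lia.
have e5 : (5 - k = (5 - k.+2).+2)%N by lia.
rewrite {}e5 in IHk; move: (5 - k.+2)%N IHk => m IHk; pose x := P ^+ m.+1 * w.
have ex : P * (P ^+ m * w) = x by rewrite mulrA -exprS.
have [//|c ec] := IHk _ (P ^+ m * w ^+ 2 *
  (24%:R^-1 * (- 12 + 8 * x - 3 * x ^+ 2 + x ^+ 3))).
  exact: ltnW.
exists (P ^+ m * w + c); rewrite -texpD ec ex.
have -> : 1 + P ^+ m.+2 * (P ^+ m * w ^+ 2 *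
    (24%:R^-1 * (-12 + 8 * x - 3 * x ^+ 2 + x ^+ 3))) = (1 + x) * texp (- x).
  apply: (mulrI unit24).
  have -> Y Z W : 24%:R * (1 + Y * (Z * (24%:R^-1 * W))) =
      24%:R + (24%:R / 24%:R) * (Y * Z * W) :> A by ring.
  rewrite divrr ?unit24 // mul1r [RHS]mulrCA /texp mulVKr ?unit24 //.
  by rewrite /texp_num /x !exprS; ring.
rewrite mulrCA -ex -[- (P * _)]mulrN texpD addrN mulr0 texp0 mulr1.
by rewrite ex.
Qed.

Lemma dvdz_mulP z : (p %| z)%Z -> exists c, z%:~R = P * c.
Proof.
by case/dvdzP=> c ->; exists c%:~R; rewrite intrM mulrC.
Qed.

(* Modulo p^5 the product over a period is a function of z(z + p), in which
   the linear and quadratic coefficients are divisible by p. *)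
Lemma prod_period : exists w k, forall t,
  - \prod_(1 <= j < p) (P * t + j%:R) =
  (1 + P * w) * (1 + P * (k * (P ^+ 2 * t * (t + 1)))).
Proof.
have [h ep] : exists h, p = h.*2.+1.
  exists p./2; rewrite -[LHS]odd_double_half.
  by case: (even_prime p_prime) p_ge7 => [->|->].
have ph : prime h.*2.+1 by rewrite -ep.
pose q : {poly A} := map_poly intr (psi h).
have qE t : \prod_(1 <= j < p) (P * t + j%:R) = q.[P ^+ 2 * t * (t + 1)].
  rewrite ep prod_pairs -ep /q map_psi horner_prod; apply: eq_bigr => j _.
  by rewrite hornerD hornerX -polyC_natr hornerC -ep; congr (_ + _); ring.
have [|w0 ew0] := @dvdz_mulP ((p.-1)`!.+1).
  by rewrite dvdzE /= -Wilson ?prime_gt1.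
have q0 : q`_0 = - (1 + P * - w0).
  have := qE 0; rewrite !mulr0 !mul0r horner_coef0 => <-.
  under eq_bigr => j _ do rewrite add0r.
  have -> : \prod_(1 <= j < p) (j%:R : A) = (p.-1)`!%:R.
    rewrite -natr_prod fact_prod prednK // prime_gt0 //.
  have ew : P * w0 = (p.-1)`!%:R + 1 by rewrite -ew0 natr1.
  by rewrite mulrN ew; ring.
have cq i : (0 < i < h)%N -> exists c, q`_i = P * c.
  move=> ih; have := dvdz_coef_psi ph ih; rewrite -ep => /dvdz_mulP[c ec].
  by exists c; rewrite coef_map.
(* From p >= 7 follows h >= 3, so the coefficients of degree 1 and 2 are both inner ones. *)
have [|c1 e1] := cq 1; first by lia.
have [|c2 e2] := cq 2; first by lia.
have uw : 1 + P * - w0 \is a GRing.unit by rewrite unitrD_nilp ?unitr1 ?nilpP.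
exists (- w0), (- c1 / (1 + P * - w0)) => t; rewrite qE.
set u := _ * _ * _.
have u3 : u ^+ 3 = 0.
  transitivity (P ^+ 5 * (P * t ^+ 3 * (t + 1) ^+ 3)); first by rewrite /u; ring.
  by rewrite P5 mul0r.
have Pu2 : P * u ^+ 2 = 0.
  transitivity (P ^+ 5 * (t ^+ 2 * (t + 1) ^+ 2)); first by rewrite /u; ring.
  by rewrite P5 mul0r.
have -> : q.[u] = q`_0 + q`_1 * u.
  rewrite (@horner_coef_wide _ (size q + 3)) ?leq_addr // addnC.
  rewrite !big_ord_recl /= /bump /= expr0 expr1 e2 big1 => [|i _].
    by rewrite mulr1 addr0 [P * c2]mulrC -mulrA Pu2 mulr0 addr0.
  by rewrite !add1n -(addn3 i) exprD u3 !mulr0.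
rewrite q0 e1; move: uw; set v := 1 + P * - w0 => uw.
transitivity (v + v / v * (P * - c1 * u)); last by ring.
by rewrite divrr //; ring.
Qed.

Lemma gamma_polynomial : exists g : {poly A},
  [/\ g.[0] = 1, forall t, g.[P * t] * g.[- (P * t)] = 1 &
      forall t, g.[P * t + P] = - g.[P * t] * \prod_(1 <= j < p) (P * t + j%:R)].
Proof.
have [w [k phiE]] := prod_period; have [c ec] := texp_surj w.
(* At x = P t, L(x + P) - L(x) = P (l1 + l3 P^2 (3t^2 + 3t + 1)); these l1 and l3 make it P (c + k
   P^2 t (t + 1)), the exponent required by [prod_period]. *)
pose l3 := 3%:R^-1 * k; pose l1 := c - l3 * P ^+ 2.
have e3 : 3 * l3 = k by rewrite /l3 mulrA divrr ?mul1r // unit3.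
pose L : {poly A} := l1 *: 'X + l3 *: 'X^3.
pose g : {poly A} := (24%:R^-1)%:P * texp_num L.
have gE x : g.[x] = texp (l1 * x + l3 * x ^+ 3).
  have tE (q : {poly A}) : (texp_num q).[x] = texp_num q.[x].
    rewrite /texp_num -!polyC_natr !hornerD !horner_exp.
    by rewrite ![(_%:P * _).[_]]hornerM !horner_exp !hornerC.
  by rewrite /g hornerM hornerC tE hornerD !hornerZ hornerX hornerXn.
exists g; split=> [|t|t].
- by rewrite gE expr0n !mulr0 addr0 texp0.
- rewrite !gE.
  have -> : l1 * (P * t) + l3 * (P * t) ^+ 3 = P * (l1 * t + l3 * P ^+ 2 * t ^+ 3).
    by ring.
  have -> : l1 * - (P * t) + l3 * (- (P * t)) ^+ 3 =
      P * - (l1 * t + l3 * P ^+ 2 * t ^+ 3) by ring.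
  by rewrite texpD subrr mulr0 texp0.
rewrite mulNr -mulrN phiE -ec !gE.
pose v := k * (P ^+ 2 * t * (t + 1)).
have -> : 1 + P * v = texp (P * v).
  have v2 : (P * v) ^+ 2 = 0.
    by rewrite -[RHS](mul0r (P * (k * t * (t + 1)) ^+ 2)) -P5 /v; ring.
  have v3 : (P * v) ^+ 3 = 0 by rewrite exprS v2 mulr0.
  have v4 : (P * v) ^+ 4 = 0 by rewrite exprS v3 mulr0.
  rewrite /texp /texp_num v2 v3 v4 !mulr0 !addr0.
  by rewrite [RHS]mulrDr mulKr ?mulVr // unit24.
have -> : l1 * (P * t + P) + l3 * (P * t + P) ^+ 3 =
    P * (l1 * t + l3 * P ^+ 2 * t ^+ 3 + (c + v)).
  by rewrite /l1 /v -e3; ring.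
have -> : l1 * (P * t) + l3 * (P * t) ^+ 3 = P * (l1 * t + l3 * P ^+ 2 * t ^+ 3).
  by ring.
by rewrite !texpD.
Qed.

End GammaPolynomial.

(** * The congruence in a ring with a fifth root of unity *)

Lemma horner_poch (A : comNzRingType) (q : {poly A}) x k :
  (pochhammer q k).[x] = pochhammer q.[x] k.
Proof. by rewrite -[LHS]/(horner_eval x _) rmorph_poch. Qed.

Section Congruence.
Variables (A : comUnitRingType) (p n N : nat) (z y : A).
Hypotheses (p_prime : prime p) (p_ge7 : (7 <= p)%N).
Local Notation P := (p%:R : A).
Hypothesis P5 : P ^+ 5 = 0.
Hypothesis z5 : 1 + z + z ^+ 2 + z ^+ 3 + z ^+ 4 = 0.
Hypotheses (pnN : (p + N = 3 * n + 1)%N) (le_Nn : (N <= n)%N).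
Hypothesis y3 : 3 * y = P.
Let m := (n - N)%N.
Let a := y - n%:R.
Local Notation poch := (@pochhammer A).

Let u3 : (3%:R : A) \is a GRing.unit := unit3 p_prime p_ge7 P5.
Let u5 : (5%:R : A) \is a GRing.unit := unit5 p_prime p_ge7 P5.

Lemma yE : y = P * 3%:R^-1.
Proof. by rewrite -y3 mulrAC divrr // mul1r. Qed.

Lemma y5 : y ^+ 5 = 0.
Proof. by rewrite yE nilpP. Qed.

Lemma aN1 : a *+ 3 + N%:R = 1.
Proof.
have e : P + N%:R = 3 * n%:R + 1 by rewrite -natrD pnN natrD natrM.
rewrite -y3 in e.
by apply: (addrI (3 * n%:R)); rewrite -e /a; ring.
Qed.

Lemma prod_zeta_poch c s k :
  poch (c + s * y) k * poch (c + s * (z * y)) k * poch (c + s * (z ^+ 2 * y)) k *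
  poch (c + s * (z ^+ 3 * y)) k * poch (c + s * (z ^+ 4 * y)) k = poch c k ^+ 5.
Proof.
have := prod_zeta_horner z5 u5 (pochhammer (c%:P + s *: 'X) k) y5.
by rewrite !horner_poch !hornerD !hornerC !hornerZ !hornerX mulr0 addr0.
Qed.

Lemma wp_sum_zeta :
  wp_sum a n (fun k => wp_pair a (a - z ^+ 2 * y) (a - z ^+ 3 * y) n k *
                       wp_pair a (a - z * y) (a - z ^+ 4 * y) n k) =
  \sum_(k < n.+1) (a + k%:R *+ 2) * (poch a k ^+ 6 / poch 1 k ^+ 6) * poch 1 n ^+ 5.
Proof.
apply: eq_bigr => k _; have le_kn : (k <= n)%N by rewrite -ltnS.
have lt_kp : (k < p)%N by lia.
have u1 : poch 1 k ^+ 6 \is a GRing.unit by rewrite unitrX ?(unit_poch1 p_prime P5).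
apply: (mulIr u1).
transitivity ((a + k%:R *+ 2) * poch a k ^+ 6 * poch 1 n ^+ 5); last first.
  transitivity ((a + k%:R *+ 2) * poch a k ^+ 6 * poch 1 n ^+ 5 *
    ((poch 1 k ^+ 6)^-1 * poch 1 k ^+ 6)); last by ring.
  by rewrite mulVr ?mulr1.
(* The binomial coefficient in [wp_sum] supplies the fifth displaced parameter a - y = -n. *)
have bn : (-1) ^+ k * 'C(n, k)%:R * poch 1 k = poch (a - y) k.
  rewrite -mulrA bin_poch // mulrA signM_self mul1r.
  by congr (poch _ _); rewrite /a; ring.
rewrite [poch 1 k ^+ 6]exprS -(prod_zeta_poch 1 1) -(prod_zeta_poch 1 1 n).
rewrite [poch a k ^+ 6]exprS -(prod_zeta_poch a (-1)) !mul1r !mulN1r -bn.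
rewrite !(@poch_split _ _ k n) // /wp_pair.
have e x : 1 + a - (a - x) = 1 + x by ring.
have -> : 1 + a + n%:R = 1 + y by rewrite /a; ring.
by rewrite !e; ring.
Qed.

(** For k > n the symbol (a)_k contains the nilpotent factor a + n = y. *)
Lemma sum_trunc : \sum_(0 <= k < p) (6 * k%:R + 3 * a) * (poch a k ^+ 6 / poch 1 k ^+ 6)
  = 3 * \sum_(k < n.+1) (a + k%:R *+ 2) * (poch a k ^+ 6 / poch 1 k ^+ 6).
Proof.
rewrite (@big_cat_nat _ _ _ n.+1) //=; last by lia.
rewrite [X in _ + X]big_nat [X in _ + X]big1 ?addr0 => [|k /andP[lt_nk _]]; last first.
  rewrite (@poch_split _ a n.+1) // pochS.
  have -> : a + n%:R = y by rewrite /a subrK.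
  by rewrite !exprMn [y ^+ 6]exprS y5 !(mulr0, mul0r).
by rewrite big_mkord mulr_sumr; apply: eq_bigr => k _; ring.
Qed.

Lemma sum_identity :
  (\sum_(0 <= k < p) (6 * k%:R + 3 * a) * (poch a k ^+ 6 / poch 1 k ^+ 6))
    * poch 1 n ^+ 5 =
  P * poch a n * poch (1 + y) n * (poch (1 - a + z * y + z ^+ 2 * y) m *
     poch (1 - a + z * y + z ^+ 3 * y) m * poch (1 - a + z * y + z ^+ 4 * y) m) *
  rsum N a 0 0 0 0 0.
Proof.
rewrite sum_trunc -mulrA mulr_suml -wp_sum_zeta whipple_sears.
have an : a + n%:R = y by rewrite /a subrK.
(* The middle factor a + n = y of (a)_(2n+1), times the 3 in front of the sum, yields the factor
   p. *)
have -> : poch a n.*2.+1 = poch a n * y * poch (1 + y) n.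
  have -> : n.*2.+1 = (n.+1 + n)%N by rewrite addSn addnn.
  by rewrite pochD pochS -natr1 addrA an [y + 1]addrC.
rewrite -y3.
set S := \sum_(j < _) _; suff -> : S = poch (1 - a + z * y + z ^+ 2 * y) m *
     poch (1 - a + z * y + z ^+ 3 * y) m * poch (1 - a + z * y + z ^+ 4 * y) m *
  rsum N a 0 0 0 0 0 by ring.
rewrite -(rsum_zeta z5 u5 aN1 y5) /rsum mulr_sumr /S.
have eN : N%:R = 1 - a *+ 3 by rewrite (canRL (addKr _) aN1) addrC.
have eq1 : a - z ^+ 2 * y + (a - z ^+ 3 * y) + (a - z * y) + (a - z ^+ 4 * y)
    - n%:R - a *+ 2 - 1 = - N%:R.
  have z5y : z * y + z ^+ 2 * y + z ^+ 3 * y + z ^+ 4 * y = - y.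
    apply/eqP; rewrite -addr_eq0; apply/eqP.
    by rewrite -[RHS](mul0r y) -z5; ring.
  transitivity (a *+ 2 - n%:R - 1 - (z * y + z ^+ 2 * y + z ^+ 3 * y + z ^+ 4 * y)).
    by ring.
  by rewrite z5y eN /a; ring.
rewrite eq1 (bigID (fun j : 'I_n.+1 => (j < N.+1)%N)) /= addrC big1 ?add0r; last first.
  move=> j; rewrite -leqNgt => lt_Nj.
  by rewrite (poch_split (- N%:R) lt_Nj) pochS addNr !(mulr0, mul0r).
rewrite [RHS](@big_ord_widen_leq _ _ _ _ n.+1) //.
apply: eq_big => [//|j]; rewrite ltnS => le_jN; rewrite inordK //.
have le_jn : (j <= n)%N := leq_trans le_jN le_Nn.
(* Both sides are (-1)^j 'C(n, j) 'C(N, j) j!, because a - y = -n. *)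
have CC : 'C(n, j)%:R * poch (- N%:R) j = 'C(N, j)%:R * poch (a - y) j.
  have -> : a - y = - n%:R by rewrite /a; ring.
  have inv i : (j <= i)%N -> poch (- i%:R) j = (-1) ^+ j * ('C(i, j)%:R * poch 1 j).
    by move=> le_ji; rewrite bin_poch // mulrA signM_self mul1r.
  by rewrite !inv //; ring.
have em : m%:R = n%:R - 1 + a *+ 3 by rewrite natrB // eN; ring.
(* Splitting off the first m factors leaves the symbols of length N - j that occur in [rsum]. *)
have -> : (n - j)%N = (m + (N - j))%N by rewrite /m; lia.
rewrite !pochD em.
have e1 x : 1 + a - (a - z * y) - (a - x) = 1 - a + z * y + x by ring.
have e2 x : 1 - a + z * y + x + (n%:R - 1 + a *+ 3) = a + z * y + y + x.
  by rewrite /a; ring.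
have -> : a - z * y - a - n%:R = a - z * y - y by rewrite /a; ring.
rewrite !e1 !e2.
move: CC; set c := 'C(n, j)%:R; set q := poch (- _) j => CC.
transitivity (c * q * poch (a - z * y) j * poch (a - z * y - y) j *
  (poch (1 - a + z * y + z ^+ 2 * y) m * poch (a + z * y + y + z ^+ 2 * y) (N - j) *
  (poch (1 - a + z * y + z ^+ 3 * y) m * poch (a + z * y + y + z ^+ 3 * y) (N - j)) *
  (poch (1 - a + z * y + z ^+ 4 * y) m * poch (a + z * y + y + z ^+ 4 * y) (N - j)))).
  by ring.
by rewrite CC; ring.
Qed.

Variable g : {poly A}.
Hypothesis g0 : g.[0] = 1.
Hypothesis gN : forall t, g.[P * t] * g.[- (P * t)] = 1.
Hypothesis gS : forall t,
  g.[P * t + P] = - g.[P * t] * \prod_(1 <= j < p) (P * t + j%:R).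

Lemma prod_poch x : \prod_(1 <= j < p) (x + j%:R) = poch (1 + x) p.-1.
Proof.
rewrite -{1}(prednK (prime_gt0 p_prime)) big_add1 big_mkord.
by apply: eq_bigr => i _; rewrite -natr1; ring.
Qed.

(* With x standing for the displacement, this polynomial is Gamma_p(1 - a + x). *)
Definition gamma1Ba : {poly A} :=
  pochhammer ((1 - y)%:P + 'X) n * (g \Po ('X - y%:P)).
Local Notation k := gamma1Ba.

Lemma gamma1BaE x : k.[x] = poch (1 - y + x) n * g.[x - y].
Proof.
by rewrite hornerM horner_comp horner_poch !hornerD hornerN !hornerC hornerX.
Qed.

(** A reflection formula. The product over one period is cut according to p - 1 = n + m + n: the
    outer blocks belong to the two values of [k], and the middle one is the symbol of length m. *)
Lemma gamma1Ba_refl t :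
  poch (1 - a + P * t) m * k.[P * t] * k.[- (P * t) - y] = (-1) ^+ n.+1.
Proof.
have yP := yE; set w := P * t.
have -> : k.[w] = poch (1 + (w - y)) n * g.[w - y].
  by rewrite gamma1BaE; congr (poch _ n * _); ring.
have -> : k.[- w - y] = poch (1 - w - y *+ 2) n * g.[- (w + y *+ 2)].
  by rewrite gamma1BaE; congr (poch _ n * g.[_]); ring.
have ep1 : p.-1 = (n + m + n)%N by rewrite /m; lia.
have := gS (t - 3%:R^-1); have := gN (t + 3%:R^-1 *+ 2).
have -> : P * (t - 3%:R^-1) = w - y by rewrite mulrBr -yP.
have -> : P * (t + 3%:R^-1 *+ 2) = w + y *+ 2 by rewrite mulrDr mulrnAr -yP.
have -> : w - y + P = w + y *+ 2 by rewrite -y3; ring.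
move=> gg; rewrite prod_poch ep1 !pochD.
have -> : poch (1 + (w - y) + (n + m)%:R) n = (-1) ^+ n * poch (1 - w - y *+ 2) n.
  apply: poch_rev_eq.
  have e : (n + m + n)%:R = 3 * y - 1.
    by rewrite -ep1 y3 -[in RHS](prednK (prime_gt0 p_prime)) -natr1 addrK.
  rewrite !natrD in e *.
  transitivity (1 + (n%:R + m%:R + n%:R - (3 * y - 1))); first by ring.
  by rewrite e subrr addr0.
have -> : 1 + (w - y) + n%:R = 1 - a + w by rewrite /a; ring.
move=> gS'.
transitivity (- (-1) ^+ n * (g.[w + y *+ 2] * g.[- (w + y *+ 2)])); last first.
  by rewrite gg exprS !mulr1 mulN1r.
rewrite gS' -[LHS]mul1r -[X in X * _ = _](signM_self _ n).
by ring.
Qed.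

(** The ten sums z^i y + z^j y with i < j form two orbits under multiplication by z, and the values
    of [k] on each multiply to k(0)^5. The six sums with i > 0 occur in the reflection formulas for
    the three symbols of length m; at the other four, [kg] and [gprod] evaluate the product. So
    k(0)^10 times these symbols is explicit, and one k(0) cancels. *)
Lemma sum_gamma :
  (\sum_(0 <= k < p) (6 * k%:R + 3 * a) * (poch a k ^+ 6 / poch 1 k ^+ 6))
    * (poch (1 - y) n * g.[- y]) ^+ 9 = - (P * rsum N a 0 0 0 0 0).
Proof.
set S := \sum_(_ <= _ < _) _; set R0 := rsum _ _ _ _ _ _ _.
have k0E : k.[0] = poch (1 - y) n * g.[- y] by rewrite gamma1BaE addr0 sub0r.
rewrite -k0E.
have yP := yE; have y5' := y5.
have gy1 : g.[y] * g.[- y] = 1 by rewrite yP gN.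
have uk0 : k.[0] \is a GRing.unit.
  rewrite k0E unitrM; apply/andP; split.
    by rewrite yP -mulrN (unit_poch p_prime P5) //; lia.
  by apply/unitrPr; exists g.[y]; rewrite mulrC.
have sumz : y + z * y + z ^+ 2 * y + z ^+ 3 * y + z ^+ 4 * y = 0.
  by rewrite -[RHS](mul0r y) -z5; ring.
have refl i (e1 e2 : A) : z * y + z ^+ i * y = e1 -> - e1 - y = e2 ->
    poch (1 - a + z * y + z ^+ i * y) m * k.[e1] * k.[e2] = (-1) ^+ n.+1.
  move=> <- <-; have := gamma1Ba_refl ((z + z ^+ i) * 3%:R^-1).
  have -> : P * ((z + z ^+ i) * 3%:R^-1) = z * y + z ^+ i * y by rewrite yP; ring.
  by rewrite addrA.
have sumz' : z * y + z ^+ 2 * y + z ^+ 3 * y + z ^+ 4 * y = - y.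
  by apply/eqP; rewrite -addr_eq0 -sumz; apply/eqP; ring.
have r2 : poch (1 - a + z * y + z ^+ 2 * y) m * k.[z * y + z ^+ 2 * y] *
    k.[z ^+ 3 * y + z ^+ 4 * y] = (-1) ^+ n.+1.
  by apply: refl => //; rewrite addrC -sumz'; ring.
have r3 : poch (1 - a + z * y + z ^+ 3 * y) m * k.[z * y + z ^+ 3 * y] *
    k.[z ^+ 2 * y + z ^+ 4 * y] = (-1) ^+ n.+1.
  by apply: refl => //; rewrite addrC -sumz'; ring.
have r4 : poch (1 - a + z * y + z ^+ 4 * y) m * k.[z * y + z ^+ 4 * y] *
    k.[z ^+ 2 * y + z ^+ 3 * y] = (-1) ^+ n.+1.
  by apply: refl => //; rewrite addrC -sumz'; ring.
have norm c : k.[c * y] * k.[c * (z * y)] * k.[c * (z ^+ 2 * y)] *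
    k.[c * (z ^+ 3 * y)] * k.[c * (z ^+ 4 * y)] = k.[0] ^+ 5.
  have := prod_zeta_horner z5 u5 (k \Po (c *: 'X)) y5'.
  by rewrite !horner_comp !hornerZ !hornerX mulr0.
have z51 : z ^+ 5 = 1 := zeta5 z5.
have n1 : k.[y + z * y] * k.[z * y + z ^+ 2 * y] * k.[z ^+ 2 * y + z ^+ 3 * y] *
    k.[z ^+ 3 * y + z ^+ 4 * y] * k.[z ^+ 4 * y + y] = k.[0] ^+ 5.
  rewrite -(norm (1 + z)); congr (k.[_] * k.[_] * k.[_] * k.[_] * k.[_]);
    try ring.
  by transitivity (z ^+ 4 * y + z ^+ 5 * y); [rewrite z51 mul1r | ring].
have n2 : k.[y + z ^+ 2 * y] * k.[z * y + z ^+ 3 * y] * k.[z ^+ 2 * y + z ^+ 4 * y] *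
    k.[z ^+ 3 * y + y] * k.[z ^+ 4 * y + z * y] = k.[0] ^+ 5.
  rewrite -(norm (1 + z ^+ 2)); congr (k.[_] * k.[_] * k.[_] * k.[_] * k.[_]);
    try ring.
    by transitivity (z ^+ 3 * y + z ^+ 5 * y); [rewrite z51 mul1r | ring].
  by transitivity (z ^+ 4 * y + z * (z ^+ 5 * y)); [rewrite z51 mul1r | ring].
have gprod : g.[y] * g.[z * y] * g.[z ^+ 2 * y] * g.[z ^+ 3 * y] * g.[z ^+ 4 * y] = 1.
  by rewrite (prod_zeta_horner z5 u5 g y5') g0 expr1n.
have kg x : k.[x + y] = poch (1 + x) n * g.[x].
  by rewrite gamma1BaE addrK; congr (poch _ n * _); ring.
have := sum_identity; rewrite -/S -/R0 -(prod_zeta_poch 1 1) !mul1r.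
have -> : poch a n = (-1) ^+ n * poch (1 - y) n.
  by apply: poch_rev_eq; rewrite /a; ring.
have uy : poch (1 + y) n \is a GRing.unit by rewrite yP (unit_poch p_prime P5) //; lia.
have uw i : poch (1 + z ^+ i * y) n \is a GRing.unit.
  by rewrite yP mulrCA (unit_poch p_prime P5) //; lia.
have uw1 : poch (1 + z * y) n \is a GRing.unit := uw 1%N.
have := uw 2%N; have := uw 3%N; have := uw 4%N.
rewrite [y + z * y]addrC [y + z ^+ 2 * y]addrC !kg in n1 n2.
rewrite [z ^+ 4 * y + z * y]addrC in n2.
move: gy1 gprod k0E r2 r3 r4 n1 n2 uk0 uw1 uy.
move: (k.[z * y + z ^+ 2 * y]) (k.[z * y + z ^+ 3 * y]) (k.[z * y + z ^+ 4 * y])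
  (k.[z ^+ 2 * y + z ^+ 3 * y]) (k.[z ^+ 2 * y + z ^+ 4 * y])
  (k.[z ^+ 3 * y + z ^+ 4 * y]) (k.[0]) => k12 k13 k14 k23 k24 k34 k0.
move: (g.[y]) (g.[- y]) (g.[z * y]) (g.[z ^+ 2 * y]) (g.[z ^+ 3 * y])
  (g.[z ^+ 4 * y]) => gy gy' g1 g2 g3 g4.
move: (poch (1 + y) n) (poch (1 - y) n) (poch (1 + z * y) n)
  (poch (1 + z ^+ 2 * y) n) (poch (1 + z ^+ 3 * y) n) (poch (1 + z ^+ 4 * y) n).
move=> w0 w0' w1 w2 w3 w4.
move: (poch (1 - a + z * y + z ^+ 2 * y) m) (poch (1 - a + z * y + z ^+ 3 * y) m)
  (poch (1 - a + z * y + z ^+ 4 * y) m) => T2 T3 T4.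
rewrite exprS; have := signM_self A n; move: ((-1) ^+ n) => eps eps1.
move=> gy1 gprod k0E r2 r3 r4 n1 n2 uk0 uw1 uy uw4 uw3 uw2 SE.
have ug : gy \is a GRing.unit by apply/unitrPr; exists gy'.
have U : k0 * (w1 * w2 * w3 * w4) * w0 \is a GRing.unit.
  by rewrite !unitrM uk0 uw1 uw2 uw3 uw4 uy.
have K : T2 * T3 * T4 * k0 ^+ 10 = - eps * (w1 * w2 * w3 * w4) * gy'.
  apply: (mulIr ug).
  transitivity ((T2 * k12 * k34) * (T3 * k13 * k24) * (T4 * k14 * k23) *
    (w1 * w2 * w3 * w4) * (gy * g1 * g2 * g3 * g4)).
    have -> : k0 ^+ 10 = k0 ^+ 5 * k0 ^+ 5 by rewrite -exprD.
    by rewrite -{1}n1 -n2; ring.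
  rewrite r2 r3 r4 gprod.
  transitivity (- eps * (eps * eps) * (w1 * w2 * w3 * w4)); first by ring.
  by rewrite eps1 -[RHS]mulrA [gy' * gy]mulrC gy1; ring.
apply: (mulIr U).
transitivity (S * (w0 * w1 * w2 * w3 * w4) * k0 ^+ 10); first by ring.
rewrite SE.
transitivity (P * eps * w0' * w0 * R0 * (T2 * T3 * T4 * k0 ^+ 10)); first by ring.
rewrite K k0E.
transitivity (- (eps * eps) * P * w0 * w0' * gy' * R0 * (w1 * w2 * w3 * w4)); first by ring.
by rewrite eps1; ring.
Qed.

End Congruence.

(** * The p-adic Gamma function as a limit *)

Section PeriodicProduct.
Variables (R : comNzRingType) (q : nat) (F : nat -> R).
Hypothesis Fq : forall k, F (k + q)%N = F k.

Lemma prod_period_shift m :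
  \prod_(m <= k < m + q) F k = \prod_(0 <= k < q) F k.
Proof.
elim: m => [//|m <-]; case: q Fq => [|r] Fr.
  by rewrite !addn0 !big_geq.
rewrite addSn big_nat_recr /= ?Fr; last by rewrite addnS ltnS leq_addr.
by rewrite [RHS]big_ltn 1?mulrC // addnS ltnS leq_addr.
Qed.

Lemma prod_periods c :
  \prod_(0 <= k < c * q) F k = (\prod_(0 <= k < q) F k) ^+ c.
Proof.
elim: c => [|c IHc]; first by rewrite big_geq.
rewrite mulSnr (@big_cat_nat _ _ _ (c * q)) //= ?leq_addr //.
by rewrite prod_period_shift IHc exprSr.
Qed.

End PeriodicProduct.

Section Wilson.
Variable p : nat.
Hypotheses (p_prime : prime p) (p_odd : odd p).

Lemma prod_coprime_Fp j :
  \prod_(0 <= k < p ^ j.+1 | ~~ (p %| k)%N) k%:R = -1 :> 'F_p.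
Proof.
have pF := pchar_Fp p_prime.
rewrite big_mkcond expnSr prod_periods => [|k]; last first.
  by rewrite dvdn_addl // natrD pchar_Fp_0 // addr0.
rewrite big_ltn ?prime_gt0 // dvdn0 mul1r.
rewrite big_nat; under eq_bigr => k /andP[k0 kp].
  rewrite gtnNdvd //; over.
rewrite -big_nat -natr_prod.
have -> : (\prod_(1 <= k < p) k = (p.-1)`!)%N.
  by rewrite fact_prod prednK ?prime_gt0.
have -> : (p.-1)`!%:R = -1 :> 'F_p.
  apply/eqP; rewrite -addr_eq0 natr1 -(dvdn_pcharf pF).
  by rewrite -Wilson ?prime_gt1.
by rewrite -signr_odd oddX p_odd orbT.
Qed.

(** Reindexing by inverses gives W^2 = 1; as W = -1 modulo the odd prime p, W - 1 is a unit, hence W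
    = -1. *)
Lemma prod_coprime_Zp j :
  \prod_(0 <= k < p ^ j.+1 | ~~ (p %| k)%N) k%:R = -1 :> 'Z_(p ^ j.+1).
Proof.
set q := (p ^ j.+1)%N; have q1 : (1 < q)%N by rewrite -(expn0 p) ltn_exp2l ?prime_gt1.
have un k : ((k%:R : 'Z_q) \is a GRing.unit) = ~~ (p %| k)%N.
  by rewrite unitZpE // coprime_pexpl // prime_coprime.
set W := LHS.
have WE : W = \prod_(x : 'Z_q | x \is a GRing.unit) x.
  rewrite /W -[in X in \prod_(_ <= _ < X | _) _](Zp_cast q1) big_mkord.
  by apply: eq_big => [x|x _]; rewrite ?natr_Zp // -un natr_Zp.
have W2 : W * W = 1.
  rewrite {1}WE WE [X in _ * X](reindex_inj (@invr_inj 'Z_q)) /=.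
  under [X in _ * X]eq_bigl => x do rewrite unitrV.
  by rewrite -big_split big1 // => x ux /=; rewrite divrr.
pose w := (\prod_(0 <= k < q | ~~ (p %| k)%N) k)%N.
have eW : W = w%:R by rewrite /W natr_prod.
have w_gt0 : (0 < w)%N.
  by rewrite /w prodn_cond_gt0 // => k; case: k => //; rewrite dvdn0.
have pw : (p %| w.+1)%N.
  rewrite (dvdn_pcharf (pchar_Fp p_prime)) -natr1 natr_prod prod_coprime_Fp.
  by rewrite addNr.
have uw : (w.-1%:R : 'Z_q) \is a GRing.unit.
  rewrite un; apply/negP => pw'; have : (p %| w.+1 - w.-1)%N by rewrite dvdn_sub.
  have -> : (w.+1 - w.-1 = 2)%N by lia.
  move/dvdn_leq => /(_ isT) p2; have := prime_gt1 p_prime.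
  by case: p p_odd p2 => [|[|[|]]].
apply/eqP; rewrite -addr_eq0; apply/eqP/(mulIr uw); rewrite mul0r.
have -> : w.-1%:R = W - 1 by rewrite eW -[in RHS](prednK w_gt0) -natr1 addrK.
by rewrite mulrC -subr_sqr expr1n expr2 W2 subrr.
Qed.

End Wilson.

Section PadicLevels.
Variable p : nat.
Implicit Types x y : padic p.

Definition padic_at j x : 'Z_(p ^ j.+1) := x j.

Fact padic_at_is_zmod_morphism j : zmod_morphism (padic_at j).
Proof. by []. Qed.
Fact padic_at_is_monoid_morphism j : monoid_morphism (padic_at j).
Proof. by []. Qed.
HB.instance Definition _ j := GRing.isZmodMorphism.Build _ _ (padic_at j)
  (padic_at_is_zmod_morphism j).
HB.instance Definition _ j := GRing.isMonoidMorphism.Build _ _ (padic_at j)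
  (padic_at_is_monoid_morphism j).

Hypothesis p_gt1 : (1 < p)%N.

Lemma pexp_gt1 j : (1 < p ^ j.+1)%N.
Proof. by rewrite -(expn0 p) ltn_exp2l. Qed.

Lemma padic_at_reduce x j i : (x (j + i)%N : nat)%:R = x j.
Proof.
elim: i => [|i IHi]; first by rewrite addn0 natr_Zp.
rewrite -IHi addnS -[x (j + i)%N]padic_valP /Zp_reduce val_Zp_nat ?pexp_gt1 //.
rewrite -[RHS]Zp_nat_mod ?pexp_gt1 // modn_dvdm ?Zp_nat_mod ?pexp_gt1 //.
by rewrite dvdn_exp2l // ltnS leq_addr.
Qed.

Lemma padic_at_eqmod m x y : padic_eqmod m.+1 x y <-> x m = y m.
Proof.
split=> [[w xy]|xy].
  apply/eqP; rewrite -subr_eq0; apply/eqP.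
  rewrite -[LHS]/(padic_at m (x - y)) xy rmorphM rmorphXn rmorph_nat /=.
  by rewrite -natrX pchar_Zp ?pexp_gt1 // mul0r.
have : (x - y) m = 0 by rewrite -[LHS]/(x m - y m) xy subrr.
rewrite /padic_eqmod; move: (x - y) => w w0.
(* Dividing a representative by p^(m+1) costs m + 1 levels, hence the shifted index. *)
pose d j := ((w (j + m.+1)%N : nat) %/ p ^ m.+1)%N.
have dvd_w j : (p ^ m.+1 %| w (m + j)%N)%N.
  have := padic_at_reduce w m j; rewrite w0 => /(congr1 val) /=.
  by rewrite val_Zp_nat ?pexp_gt1 // => /eqP.
have dP j : Zp_reduce ((d j.+1)%:R : 'Z_(p ^ j.+2)) = (d j)%:R.
  rewrite Zp_reduce_nat /d.
  have := padic_at_reduce w (j + m.+1) 1; rewrite addn1 => /(congr1 val) /=.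
  rewrite val_Zp_nat ?pexp_gt1 // => e.
  rewrite -[RHS](congr1 (fun k : nat => (k %/ _)%N%:R) e) addSn.
  set W := (w (j + m.+1).+1 : nat).
  have := divn_eq W (p ^ (j + m.+1).+1) => eW.
  rewrite [in LHS]eW.
  have -> : (p ^ (j + m.+1).+1 = p ^ j.+1 * p ^ m.+1)%N by rewrite -expnD addSn.
  rewrite mulnA divnMDl ?expn_gt0 ?(ltnW p_gt1) //.
  by rewrite natrD natrM pchar_Zp ?pexp_gt1 // mulr0 add0r.
exists (Padic dP); apply: padic_ext => j.
rewrite -[RHS]/(padic_at j (p%:R ^+ m.+1 * Padic dP)) rmorphM rmorphXn rmorph_nat.
rewrite /= -natrX -natrM mulnC divnK; last by rewrite addnS -addSn addnC dvd_w.
by rewrite padic_at_reduce.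
Qed.

Lemma hausdorff_padic : hausdorff_space (padic p).
Proof.
move=> x y xy; apply: padic_ext => j.
have [||z [zx zy]] := xy [set u | padic_eqmod j.+1 u x]%classic
  [set u | padic_eqmod j.+1 u y]%classic.
- by exists j.+1.
- by exists j.+1.
by rewrite -(proj1 (padic_at_eqmod j z x) zx) (proj1 (padic_at_eqmod j z y) zy).
Qed.

(** The summand p^(j+1) keeps the representative positive, as [padic_approx] demands, even when
    [x j] is 0. *)
Definition padic_nat x j : nat := ((x j : nat) + p ^ j.+1)%N.

Lemma padic_nat_gt0 x j : (0 < padic_nat x j)%N.
Proof. by rewrite addn_gt0 expn_gt0 (ltnW p_gt1) orbT. Qed.

Lemma padic_natE x j : (padic_nat x j)%:R = x j.
Proof. by rewrite natrD pchar_Zp ?pexp_gt1 // addr0 natr_Zp. Qed.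

Lemma padic_approx_proper x : ProperFilter (padic_approx x).
Proof.
apply: filter_from_proper => [|m _]; last first.
  exists (padic_nat x m); split; first exact: padic_nat_gt0.
  apply: padic_eqmod_leq (leqnSn m) _; apply/padic_at_eqmod.
  by rewrite -[LHS]/(padic_at m _) rmorph_nat padic_natE.
apply: filter_from_filter; first by exists 0%N.
move=> i j _ _; exists (maxn i j) => // n [n0 nx]; split; split=> //.
  exact: padic_eqmod_leq (leq_maxl i j) nx.
exact: padic_eqmod_leq (leq_maxr i j) nx.
Qed.

End PadicLevels.

Lemma eqmod_Zp q n m : (1 < q)%N -> n%:R = m%:R :> 'Z_q -> n = m %[mod q].
Proof. by move=> q1 /(congr1 val); rewrite /= !val_Zp_nat. Qed.

Section GammaLimit.
Variable p : nat.
Hypotheses (p_prime : prime p) (p_odd : odd p).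
Implicit Types x : padic p.
Let p_gt1 : (1 < p)%N := prime_gt1 p_prime.

Lemma pGamma_natD n m : (0 < n)%N -> pGamma_nat p (n + m) =
  pGamma_nat p n * (-1) ^+ m * \prod_(n <= k < n + m | ~~ (p %| k)%N) k%:R.
Proof.
move=> n0; rewrite /pGamma_nat (@big_cat_nat _ _ _ n) ?leq_addr //= exprD; ring.
Qed.

(** The product over the added block is -1 by Wilson, and so is the added sign since p is odd. *)
Lemma pGamma_nat_period n j : (0 < n)%N ->
  pGamma_nat p (n + p ^ j.+1) j = pGamma_nat p n j.
Proof.
move=> n0; rewrite pGamma_natD //; move: (pGamma_nat p n) => g.
rewrite -[LHS]/(padic_at j _) !rmorphM rmorphXn rmorphN1 rmorph_prod.
under eq_bigr => k _ do rewrite rmorph_nat.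
rewrite big_mkcond prod_period_shift => [|k]; last first.
  by rewrite natrD pchar_Zp ?pexp_gt1 // addr0 dvdn_addl // expnS dvdn_mulr.
rewrite -big_mkcond prod_coprime_Zp // -signr_odd oddX p_odd orbT expr1.
by rewrite mulrN1 mulrN1 opprK.
Qed.

Lemma pGamma_nat_congr n m j : (0 < n)%N -> (0 < m)%N ->
  n = m %[mod p ^ j.+1] -> pGamma_nat p n j = pGamma_nat p m j.
Proof.
wlog le_nm : n m / (n <= m)%N.
  move=> th n0 m0 nm; case/orP: (leq_total n m) => [/th|/th ->//]; exact.
move=> n0 m0 /esym/eqP; rewrite eqn_mod_dvd // => /dvdnP[c ec].
rewrite -(subnKC le_nm) {}ec; elim: c => [|c IHc]; first by rewrite addn0.
by rewrite IHc mulSnr addnA pGamma_nat_period // addn_gt0 n0.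
Qed.

(** Values at representatives of x are coherent by [pGamma_nat_congr], so they form a p-adic
    integer; it is the limit, and each of its levels is read off at a single integer. *)
Lemma pGammaE x j n : (0 < n)%N -> n%:R = x j ->
  pGamma x j = pGamma_nat p n j.
Proof.
have gP i : Zp_reduce (pGamma_nat p (padic_nat x i.+1) i.+1) =
    pGamma_nat p (padic_nat x i) i.
  rewrite padic_valP; apply: pGamma_nat_congr; rewrite ?padic_nat_gt0 //.
  apply: (eqmod_Zp (pexp_gt1 p_gt1 i)); rewrite padic_natE // natrD.
  have -> : (p ^ i.+2)%:R = 0 :> 'Z_(p ^ i.+1).
    by rewrite (expnS p i.+1) natrM pchar_Zp ?pexp_gt1 // mulr0.
  by rewrite addr0; apply: padic_valP.
pose G : padic p := Padic gP.
have GE m i : (0 < m)%N -> m%:R = x i -> pGamma_nat p m i = G i.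
  move=> m0 mx; apply: pGamma_nat_congr; rewrite ?padic_nat_gt0 //.
  by apply: (eqmod_Zp (pexp_gt1 p_gt1 i)); rewrite padic_natE.
move=> n0 nx; rewrite (GE n) //; congr (padic_val _ j).
have xF := padic_approx_proper p_gt1 x.
apply: cvg_lim; first exact: hausdorff_padic.
move=> U [m _ mU]; exists m.+1 => // k [k0 kx]; apply: mU.
apply: padic_eqmod_leq (leqnSn m) _; apply/padic_at_eqmod => //.
apply: GE => //; rewrite -(proj1 (padic_at_eqmod p_gt1 m _ _) kx).
by rewrite -[RHS]/(padic_at m _) rmorph_nat.
Qed.

End GammaLimit.

(** * Transfer to the p-adic integers *)

Section PadicUnits.
Variable p : nat.
Hypothesis p_prime : prime p.
Let p_gt1 : (1 < p)%N := prime_gt1 p_prime.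

Lemma unit_padic0 (x : padic p) : padic_at 0 x \is a GRing.unit -> x \is a GRing.unit.
Proof.
move=> ux; apply/asboolP => j.
have := padic_at_reduce p_gt1 x 0 j; rewrite add0n => e.
rewrite -[x j]natr_Zp unitZpE ?pexp_gt1 // coprime_pexpl //.
by move: ux; rewrite /padic_at -e unitZpE ?pexp_gt1 // coprime_pexpl.
Qed.

Lemma unit_Zp1 k : (k%:R : 'Z_(p ^ 1)) \is a GRing.unit = ~~ (p %| k)%N.
Proof. by rewrite unitZpE ?(pexp_gt1 p_gt1 0) // expn1 prime_coprime. Qed.

Lemma unit_padic_nat k : ~~ (p %| k)%N -> (k%:R : padic p) \is a GRing.unit.
Proof.
move=> pk; apply: unit_padic0.
by rewrite rmorph_nat unit_Zp1.
Qed.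

Lemma unit_padic_natD k (x : padic p) : ~~ (p %| k)%N ->
  (k%:R + p%:R * x : padic p) \is a GRing.unit.
Proof.
move=> pk; apply: unit_padic0.
rewrite rmorphD rmorphM !rmorph_nat.
by rewrite -[p in p%:R * _]expn1 pchar_Zp ?(pexp_gt1 p_gt1 0) // mul0r addr0 unit_Zp1.
Qed.

Lemma pGamma_unit (x : padic p) : odd p -> pGamma x \is a GRing.unit.
Proof.
move=> p_odd; apply: unit_padic0.
rewrite /padic_at (pGammaE p_prime p_odd (padic_nat_gt0 p_gt1 x 0) (padic_natE p_gt1 x 0)).
rewrite -[pGamma_nat _ _ _]/(padic_at 0 _) rmorphM rmorphXn rmorphN1 rmorph_prod.
rewrite unitrM unitrX ?unitrN1 // rpred_prod // => k pk.
by rewrite rmorph_nat unit_Zp1.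
Qed.

End PadicUnits.

(** * Matching the right-hand side *)

Section RightHandSide.
Variables (A : comUnitRingType) (p n N : nat) (y : A).
Hypotheses (p_prime : prime p) (p_ge7 : (7 <= p)%N).
Local Notation P := (p%:R : A).
Hypothesis P5 : P ^+ 5 = 0.
Hypotheses (pnN : (p + N = 3 * n + 1)%N) (le_Nn : (N <= n)%N).
Hypothesis y3 : 3 * y = P.
Let m := (n - N)%N.
Let a := y - n%:R.
Let c := 1 + m%:R - y.
Local Notation poch := (@pochhammer A).
Variable g : {poly A}.
Hypothesis gN : forall t, g.[P * t] * g.[- (P * t)] = 1.

Let yP : y = P * 3%:R^-1 := yE p_prime p_ge7 P5 y3.

Lemma unit_poch_c k : (k <= N)%N -> poch c k \is a GRing.unit.
Proof.
move=> le_kN; apply: rpred_prod => i _.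
have -> : c + i%:R = (m + i).+1%:R + P * (- 3%:R^-1).
  by rewrite mulrN -yP /c -natr1 natrD; ring.
rewrite unitrD_nilp ?nilpP // (unit_lt p_prime P5) //.
by have := ltn_ord i; rewrite /m; lia.
Qed.

(** Since a + c = 1 - N, reversing (c + k)_(N-k) gives (a)_(N-k) up to sign, as in [rsum]. *)
Lemma sum_4F3 :
  (\sum_(0 <= k < N.+1) (poch (- N%:R) k * poch a k ^+ 3) / (poch 1 k * poch c k ^+ 3))
   * poch c N ^+ 3 = (-1) ^+ N * rsum N a 0 0 0 0 0.
Proof.
rewrite big_mkord mulr_suml mulr_sumr; apply: eq_bigr => k _.
have le_kN : (k <= N)%N by rewrite -ltnS.
have u : poch 1 k * poch c k ^+ 3 \is a GRing.unit.
  by rewrite unitrM unitrX ?unit_poch_c // (unit_poch1 p_prime P5) //; lia.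
rewrite mulrAC; apply: (mulIr u); rewrite mulrVK // (poch_split c le_kN).
have -> : poch (c + k%:R) (N - k) = (-1) ^+ (N - k) * poch a (N - k).
  by apply: poch_rev_eq; rewrite /a /c /m !natrB //; ring.
have -> : poch (- N%:R) k = (-1) ^+ k * ('C(N, k)%:R * poch 1 k).
  by rewrite bin_poch // mulrA signM_self mul1r.
rewrite !subr0 !addr0 -[in (-1) ^+ N](subnKC le_kN) exprD.
transitivity ('C(N, k)%:R * poch 1 k * poch a k ^+ 3 * poch c k ^+ 3 * poch a (N - k) ^+ 3
  * ((-1) ^+ k * (-1) ^+ (N - k) * ((-1) ^+ (N - k) * (-1) ^+ (N - k)))); first by ring.
by rewrite signM_self mulr1; ring.
Qed.

(** [G1] and [G2] stand for Gamma_p(r/3) and Gamma_p(2r/3). Then [G1] is the inverse of [k0], and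
    [k0] is -G2 (c)_N; the ninth power splits as k0^6 k0^3, and the cube of (c)_N clears the sum. *)
Lemma gamma_rhs (S G1 G2 : A) :
    S * (poch (1 - y) n * g.[- y]) ^+ 9 = - (P * rsum N a 0 0 0 0 0) ->
    G1 * poch (1 - y) n = g.[y] -> G2 = - (g.[- y] * poch (1 - y) m) ->
    G2 \is a GRing.unit ->
  S = (-1) ^+ N * P * (G1 ^+ 6 / G2 ^+ 3) *
   \sum_(0 <= k < N.+1) (poch (- N%:R) k * poch a k ^+ 3) / (poch 1 k * poch c k ^+ 3).
Proof.
set k0 := poch (1 - y) n * _ => SE G1E G2E uG2.
have gy : g.[y] * g.[- y] = 1 by rewrite yP gN.
have G1k : G1 * k0 = 1 by rewrite /k0 mulrA G1E gy.
have uk : k0 \is a GRing.unit by apply/unitrPr; exists G1; rewrite mulrC.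
have G2k : k0 = - (G2 * poch c N).
  rewrite G2E /k0 /c -[n in LHS](subnK le_Nn) pochD -/m.
  have e : 1 - y + m%:R = 1 + m%:R - y by ring.
  by rewrite e; ring.
have := sum_4F3; set S0 := \sum_(_ <= _ < _) _; set R0 := rsum _ _ _ _ _ _ _ => S0E.
apply: (mulIr (unitrX 9 uk)); rewrite SE -/R0.
transitivity ((-1) ^+ N * P * (G1 * k0) ^+ 6 * k0 ^+ 3 / G2 ^+ 3 * S0); last by ring.
rewrite G1k expr1n mulr1 [k0]G2k.
transitivity (- ((-1) ^+ N * P * (G2 ^+ 3 / G2 ^+ 3) * (S0 * poch c N ^+ 3))); last by ring.
rewrite S0E divrr ?unitrX // mulr1.
transitivity (- (P * ((-1) ^+ N * (-1) ^+ N) * R0)); first by rewrite signM_self; ring.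
by ring.
Qed.

End RightHandSide.

(** * Gamma_p near multiples of p *)

Section GammaValues.
Variables (A : comUnitRingType) (p : nat) (f : {rmorphism padic p -> A}).
Hypotheses (p_prime : prime p) (p_odd : odd p).
Local Notation P := (p%:R : A).
Local Notation gam n := (f (pGamma_nat p n)).

Lemma gamD n i : gam (n + i) =
  gam n * (-1) ^+ i * \prod_(n <= k < n + i | ~~ (p %| k)%N) k%:R.
Proof.
have gamE j : gam j = (-1) ^+ j * \prod_(0 <= k < j | ~~ (p %| k)%N) k%:R.
  rewrite rmorphM rmorphXn rmorphN1 rmorph_prod; congr (_ * _).
  under eq_bigr => k _ do rewrite rmorph_nat.
  by case: j => [|j]; [rewrite !big_geq | rewrite [RHS]big_ltn_cond // dvdn0].
rewrite !gamE [X in _ * X = _](@big_cat_nat _ _ _ n) ?leq_addr //= exprD.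
by ring.
Qed.

Lemma prod_nodvd n i : (forall j, (j < i)%N -> ~~ (p %| n + j)%N) ->
  \prod_(n <= k < n + i | ~~ (p %| k)%N) k%:R = pochhammer n%:R i :> A.
Proof.
move=> pn; rewrite -{1}[n]add0n big_addn addKn big_mkord; apply: eq_big => [k|k _].
  by rewrite addnC pn.
by rewrite natrD addrC.
Qed.

Lemma gam_block t i : (i < p)%N -> gam (p * t + i.+1) =
  gam (p * t) * (-1) ^+ i.+1 * pochhammer (1 + P * t%:R) i.
Proof.
move=> lt_ip; rewrite gamD big_ltn_cond ?addnS ?ltnS ?leq_addr //.
rewrite dvdn_mulr //= -addSn prod_nodvd => [|j lt_ji].
  by rewrite -natr1 natrM addrC.
rewrite addSn -addnS dvdn_addr ?dvdn_mulr // gtnNdvd //.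
exact: leq_ltn_trans lt_ji lt_ip.
Qed.

Variable g : {poly A}.
Hypothesis g0 : g.[0] = 1.
Hypothesis gS : forall t,
  g.[P * t + P] = - g.[P * t] * \prod_(1 <= j < p) (P * t + j%:R).

(** Both sides change by the same factor from t to t + 1. *)
Lemma gam_mul t : gam (p * t) = g.[P * t%:R].
Proof.
elim: t => [|t IHt].
  by rewrite muln0 mulr0 g0 /pGamma_nat big_geq // mulr1 rmorph1.
have p0 := prime_gt0 p_prime.
rewrite mulnS addnC -[X in (_ + X)%N](prednK p0) gam_block ?prednK // IHt.
rewrite -natr1 mulrDr mulr1 gS prod_poch // -signr_odd p_odd expr1.
by ring.
Qed.

Lemma gam_below t n : (0 < t)%N -> (n < p)%N ->
  gam (p * t - n) * pochhammer (1 - P * t%:R) n = gam (p * t).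
Proof.
move=> t0 lt_np; have le_n : (n <= p * t)%N.
  by apply: leq_trans (ltnW lt_np) _; rewrite leq_pmulr.
rewrite -[in RHS](subnK le_n) gamD prod_nodvd => [|j lt_jn].
  rewrite -mulrA; congr (_ * _).
  by apply: poch_rev_eq; rewrite natrB // natrM; ring.
have -> : (p * t - n + j = p * t - (n - j))%N by lia.
rewrite dvdn_subr ?dvdn_mulr //; last by lia.
by rewrite gtnNdvd //; lia.
Qed.

End GammaValues.

Section Supercongruence.
Variables (A : comUnitRingType) (p n N : nat) (z : A).
Variable f : {rmorphism padic p -> A}.
Hypotheses (p_prime : prime p) (p_ge7 : (7 <= p)%N).
Hypothesis f_at : forall x y : padic p, x 4%N = y 4%N -> f x = f y.
Hypothesis z5 : 1 + z + z ^+ 2 + z ^+ 3 + z ^+ 4 = 0.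
Hypotheses (pnN : (p + N = 3 * n + 1)%N) (le_Nn : (N <= n)%N).
Let m := (n - N)%N.
Local Notation P := (p%:R : A).
Local Notation r := (1 - N%:R : padic p).

Let p_odd : odd p.
Proof. by case: (even_prime p_prime) p_ge7 => // ->. Qed.

Let P5 : P ^+ 5 = 0.
Proof.
rewrite -(rmorph_nat f) -rmorphXn -(rmorph0 f); apply: f_at.
rewrite -[LHS]/(padic_at 4 _) rmorphXn rmorph_nat -natrX.
by rewrite pchar_Zp ?pexp_gt1 // prime_gt1.
Qed.

Let u3 : (3%:R : padic p) \is a GRing.unit.
Proof. by rewrite unit_padic_nat // gtnNdvd //; lia. Qed.

Let y := f (p%:R / 3).

Let y3 : 3 * y = P.
Proof. by rewrite -(rmorph_nat f 3) -rmorphM mulrC divrK // rmorph_nat. Qed.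

Lemma padic_third : r / 3 = p%:R / 3 - n%:R.
Proof.
apply: (mulIr u3); rewrite [RHS]mulrBl !divrK //.
have e : p%:R + N%:R = 3 * n%:R + 1 :> padic p by rewrite -natrD pnN natrD natrM.
by rewrite -[p%:R](addrK N%:R) e; ring.
Qed.

Lemma padic_two_thirds : 2 * r / 3 = m.+1%:R + p%:R * - 3^-1.
Proof.
have e : p%:R + N%:R = 3 * n%:R + 1 :> padic p by rewrite -natrD pnN natrD natrM.
apply: (mulIr u3); rewrite divrK //.
transitivity (m.+1%:R * 3 - p%:R * (3%:R^-1 * 3%:R) : padic p); last by ring.
rewrite mulVr // mulr1 -(natr1 m) natrB //.
by rewrite -[p%:R](addrK N%:R) e; ring.
Qed.

Lemma supercongruence_in :
  f (\sum_(0 <= k < p) (6 * k%:R + r) *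
      (pochhammer (r / 3) k ^+ 6 / pochhammer 1 k ^+ 6)) =
  f ((-1) ^+ N * p%:R * (pGamma (r / 3) ^+ 6 / pGamma (2 * r / 3) ^+ 3) *
     \sum_(0 <= k < N.+1) (pochhammer (r - 1) k * pochhammer (r / 3) k ^+ 3) /
       (pochhammer 1 k * pochhammer (2 * r / 3) k ^+ 3)).
Proof.
have [g [g0 gN gS]] := gamma_polynomial p_prime p_ge7 P5.
have aE : f (r / 3) = y - n%:R by rewrite padic_third rmorphB rmorph_nat.
have yP : y = P * 3%:R^-1 := yE p_prime p_ge7 P5 y3.
have cE : f (2 * r / 3) = 1 + m%:R - y.
  rewrite padic_two_thirds rmorphD rmorphM !rmorph_nat rmorphN rmorphV //.
  by rewrite rmorph_nat mulrN -yP -natr1 [m%:R + 1]addrC.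
have rE : f r = 3 * (y - n%:R).
  by rewrite -aE -(rmorph_nat f 3) -rmorphM mulrC divrK.
have up k : (k < p)%N -> (pochhammer 1 k : padic p) \is a GRing.unit.
  move=> lt_kp; apply: rpred_prod => i _.
  by rewrite addrC natr1 unit_padic_nat // gtnNdvd //; have := ltn_ord i; lia.
have uc k : (k <= N)%N -> pochhammer (2 * r / 3) k \is a GRing.unit.
  move=> le_kN; apply: rpred_prod => i _; rewrite padic_two_thirds addrAC -natrD.
  by rewrite unit_padic_natD // gtnNdvd //; have := ltn_ord i; rewrite /m; lia.
have uG2 := pGamma_unit p_prime (2 * r / 3) p_odd.
rewrite [RHS]rmorphM rmorphM rmorphM rmorphXn rmorphN1 rmorph_nat.
rewrite rmorphM rmorphV ?unitrX // !rmorphXn.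
rewrite [in RHS]rmorph_sum rmorph_sum.
(* A positive integer congruent to 1/3 modulo p^5, so that p t stands for [y] and p t - n for
   r/3. *)
pose t := padic_nat (3%:R^-1 : padic p) 4.
have p1 := prime_gt1 p_prime.
have t0 : (0 < t)%N by apply: padic_nat_gt0.
have t_at : t%:R = (3%:R^-1 : padic p) 4 := padic_natE p1 3%:R^-1 4.
have tE : f t%:R = 3%:R^-1.
  rewrite -(rmorph_nat f) -rmorphV //; apply: f_at.
  by rewrite -[LHS]/(padic_at 4 _) rmorph_nat t_at.
have ty : P * t%:R = y by rewrite -(rmorph_nat f t) tE yP.
have pGammaA x k : (0 < k)%N -> k%:R = padic_at 4 x ->
    f (pGamma x) = f (pGamma_nat p k).
  by move=> k0 kx; apply: f_at; apply: pGammaE.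
have n_lt : (n < p)%N by lia.
have n_le : (n <= p * t)%N.
  by apply: leq_trans (ltnW n_lt) _; rewrite leq_pmulr.
under eq_big_nat => k /andP[_ lt_kp].
  rewrite rmorphM rmorphD rmorphM !rmorph_nat rE.
  rewrite (rmorphM f (_ ^+ 6)) rmorphV ?unitrX ?up // !rmorphXn !rmorph_poch aE rmorph1.
  over.
under [in RHS]eq_big_nat => k /andP[_ le_kN].
  rewrite (rmorphM f (_ * _)) rmorphV ?unitrM ?unitrX ?uc ?up //; last first.
    by rewrite /m in le_kN *; lia.
  rewrite !(rmorphM f _ (_ ^+ 3)) !rmorphXn !rmorph_poch aE cE rmorphB rmorph1.
  over.
have -> : f r - 1 = - N%:R by rewrite rmorphB rmorph1 rmorph_nat; ring.
apply: (gamma_rhs p_prime p_ge7 P5 pnN le_Nn y3 gN).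
- exact: (sum_gamma p_prime p_ge7 P5 z5 pnN le_Nn y3 g0 gN gS).
- rewrite (@pGammaA _ (p * t - n)%N) //; first last.
  + by rewrite padic_third rmorphB rmorphM !rmorph_nat natrB // natrM t_at.
  + by rewrite subn_gt0 (leq_trans n_lt) // leq_pmulr.
  by rewrite -[in pochhammer _ _]ty gam_below // (gam_mul f p_prime p_odd g0 gS) ty.
(* A natural number representing -1/3; recall that 2r/3 = m + 1 - p/3. *)
- pose t' := (t * (p ^ 5).-1)%N.
  have p5 : (0 < p ^ 5)%N by rewrite expn_gt0 prime_gt0.
  have ty' : P * t'%:R = - y.
    rewrite natrM -[(p ^ 5).-1%:R](addrK 1) natr1 prednK // natrX P5 -ty.
    by ring.
  rewrite (@pGammaA _ (p * t' + m.+1)%N) //; first last.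
  + rewrite padic_two_thirds mulrN rmorphB rmorphM !rmorph_nat /= /padic_at -t_at addrC.
    rewrite natrD !natrM -[(p ^ 5).-1%:R](addrK 1) natr1 prednK //.
    by rewrite pchar_Zp ?(pexp_gt1 p1 4) //; ring.
  + by rewrite addnS.
  rewrite gam_block //; last by rewrite /m; lia.
  rewrite (gam_mul f p_prime p_odd g0 gS) ty' -signr_odd /=.
  (* As p = 3n + 1 - N is odd, m is even and the sign (-1)^(m+1) is -1. *)
  have -> : odd m = false by rewrite /m; lia.
  by rewrite expr1; ring.
- exact: rmorph_unit.
Qed.

End Supercongruence.

(** * Adjoining a fifth root of unity *)

Section ZetaRing.
Variable R : comNzRingType.

Definition Phi5 : {poly R} := \poly_(i < 5) 1.

Definition zeta_ring := {poly %/ Phi5}.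
HB.instance Definition _ := GRing.ComNzRing.on zeta_ring.

(** Deciding invertibility classically turns the quotient into a unit ring, as [A] has to be. *)
Definition zeta_unit : {pred zeta_ring} := fun x => `[< exists u, u * x = 1 >].

Definition zeta_inv (x : zeta_ring) : zeta_ring :=
  if pselect (exists u, u * x = 1) is left ux then sval (cid ux) else x.

Fact zeta_mulV : {in zeta_unit, left_inverse 1 zeta_inv *%R}.
Proof.
move=> x /asboolP ux; rewrite /zeta_inv; case: pselect => // ux'.
by case: cid.
Qed.

Fact zeta_unitPl (x u : zeta_ring) : u * x = 1 -> zeta_unit x.
Proof. by move=> ux; apply/asboolP; exists u. Qed.

Fact zeta_inv_out : {in [predC zeta_unit], zeta_inv =1 id}.
Proof. by move=> x /asboolP ux; rewrite /zeta_inv; case: pselect. Qed.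

HB.instance Definition _ := GRing.ComNzRing_hasMulInverse.Build zeta_ring
  zeta_mulV zeta_unitPl zeta_inv_out.

Definition zeta_const (a : R) : zeta_ring := qpolyC Phi5 a.
Fact zeta_const_is_zmod_morphism : zmod_morphism zeta_const.
Proof. exact: qpolyC_is_zmod_morphism. Qed.
Fact zeta_const_is_monoid_morphism : monoid_morphism zeta_const.
Proof. exact: qpolyC_is_monoid_morphism. Qed.
HB.instance Definition _ := GRing.isZmodMorphism.Build R zeta_ring zeta_const
  zeta_const_is_zmod_morphism.
HB.instance Definition _ := GRing.isMonoidMorphism.Build R zeta_ring zeta_const
  zeta_const_is_monoid_morphism.

Lemma zeta_const_inj : injective zeta_const.
Proof. by move=> a b /(congr1 val) /polyC_inj. Qed.

Definition zeta : zeta_ring := in_qpoly Phi5 'X.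

Lemma sum_zeta : 1 + zeta + zeta ^+ 2 + zeta ^+ 3 + zeta ^+ 4 = 0.
Proof.
have e : Phi5 = 1 + 'X + 'X ^+ 2 + 'X ^+ 3 + 'X ^+ 4.
  by rewrite /Phi5 poly_def !big_ord_recr big_ord0 /= !scale1r add0r expr0 expr1.
have mPhi : Phi5 \is monic.
  by rewrite monicE lead_coef_poly // oner_neq0.
have sPhi : size Phi5 = 5 by rewrite size_poly_eq ?oner_neq0.
transitivity (in_qpoly Phi5 Phi5).
  by rewrite {2}e !rmorphD !rmorphXn rmorph1.
apply: val_inj; rewrite /= /mk_monic sPhi mPhi /=.
exact: Pdiv.RingMonic.rmodpp.
Qed.

End ZetaRing.

Theorem theorem1p2 (r : int) (p : nat)
  (r_le1 : r <= 1) (r_coprime3 : coprimez r 3)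
  (p_prime : prime p) (p_ge7 : (7 <= p)%N)
  (p_eq_r : (p%:Z = r %[mod 3])%Z) (p_ge : 3 - 2 * r <= p%:Z) :
  padic_eqmod 5
    (\sum_(0 <= k < p)
       (6 * k%:R + r%:~R) * (pochhammer (r%:~R / 3 : padic p) k ^+ 6
                             / pochhammer (1 : padic p) k ^+ 6))
    ((-1) ^ (r + 1) * p%:R
     * (pGamma (r%:~R / 3 : padic p) ^+ 6
        / pGamma ((2 * r%:~R) / 3 : padic p) ^+ 3)
     * \sum_(0 <= k < (absz (1 - r)%R).+1)
         (pochhammer (r%:~R - 1 : padic p) k
          * pochhammer (r%:~R / 3 : padic p) k ^+ 3)
         / (pochhammer (1 : padic p) k
            * pochhammer ((2 * r%:~R) / 3 : padic p) k ^+ 3)).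
Proof.
set N := absz (1 - r); have rN : r = 1 - N%:Z by rewrite /N; lia.
(* The number p - r = p + N - 1 is a multiple of 3. *)
have [n pnN] : exists n, (p + N = 3 * n + 1)%N.
  move/eqP: p_eq_r; rewrite eqz_mod_dvd => /dvdzP[q eq].
  by exists (absz q); lia.
have le_Nn : (N <= n)%N by lia.
have rE : r%:~R = 1 - N%:R :> padic p by rewrite rN rmorphB.
have sgnE : (-1) ^ (r + 1) = (-1) ^+ N :> padic p.
  (* The exponent r + 1 = 2 - N has the parity of N but is negative for N > 2. *)
  rewrite rN; case: (N) => [|[|k]].
  - by rewrite subr0 expr0 -exprnP expr2 mulrNN mulr1.
  - by rewrite addrAC addrK.
  have -> : (1 - k.+2%:Z + 1 = - k%:Z)%R by lia.
  rewrite -exprnN -exprVn invrN1 exprSr exprSr.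
  by rewrite -mulrA mulrNN !mulr1.
rewrite rE sgnE; apply/(padic_at_eqmod (prime_gt1 p_prime)).
pose f : {rmorphism padic p -> zeta_ring 'Z_(p ^ 4.+1)} :=
  GRing.RMorphism.clone _ _ (@zeta_const _ \o @padic_at p 4) _.
have f_at (x x' : padic p) : x 4 = x' 4 -> f x = f x'.
  by move=> xx'; rewrite /= /padic_at xx'.
(* Constants embed injectively, so equality in the extension gives equality at level 4, that is
   modulo p^5. *)
apply: (@zeta_const_inj 'Z_(p ^ 4.+1)).
exact: (supercongruence_in p_prime p_ge7 f_at (sum_zeta _) pnN le_Nn).
Qed.
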